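(* Let $\mathbb{k}$ be a field of characteristic zero, let $R$ be a prime $\mathbb{k}$-algebra, and let $A=\sigma(R)\langle x_1,\dots,x_n\rangle$ be a bijective skew PBW extension of $R$, with $n\ge 1$. If $A$ satisfies the PI property, then the center of $A$ is non-trivial, that is, $Z(A)\neq\mathbb{k}$.
   Context: A ring $A$ satisfies the PI property if there is a polynomial $f\in\mathbb{Z}\langle X_1,\dots,X_m\rangle$ in noncommuting variables which is monic (at least one of the monomials of highest total degree appearing in $f$ has coefficient $1$) and such that $f(a_1,\dots,a_m)=0$ for all $a_1,\dots,a_m\in A$. The center is called trivial if $Z(A)=\mathbb{k}$. Skew PBW extension: let $R\subseteq A$ be rings. $A$ is a skew PBW extension of $R$, written $A=\sigma(R)\langle x_1,\dots,x_n\rangle$, if (i) $R$ is a subring of $A$; (ii) there are $x_1,\dots,x_n\in A$ such that $A$ is a free left $R$-module with basis $\{x_1^{\alpha_1}\cdots x_n^{\alpha_n}\mid \alpha\in\mathbb{N}^n\}$; (iii) for every $1\le i\le n$ and $r\in R\setminus\{0\}$ there is $c_{i,r}\in R\setminus\{0\}$ with $x_ir-c_{i,r}x_i\in R$; (iv) for every $1\le i,j\le n$ there is $c_{i,j}\in R\setminus\{0\}$ with $x_jx_i-c_{i,j}x_ix_j\in R+Rx_1+\cdots+Rx_n$. Then for each $i$ there are an injective ring endomorphism $\sigma_i$ of $R$ and a $\sigma_i$-derivation $\delta_i$ of $R$ with $x_ir=\sigma_i(r)x_i+\delta_i(r)$ for all $r\in R$. $A$ is bijective if every $\sigma_i$ is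 bijective and $c_{i,j}$ is invertible for all $1\le i<j\le n$. *)

(* Defs.v *)
From mathcomp Require Import all_boot all_order all_algebra.
From mathcomp Require Import monalg.

Set Implicit Arguments.
Unset Strict Implicit.
Unset Printing Implicit Defensive.

Import GRing.Theory.
Local Open Scope ring_scope.

Definition prime_ring (R : nzRingType) : Prop :=
  forall a b : R, (forall r : R, a * r * b = 0) -> a = 0 \/ b = 0.

Definition invertible (R : nzRingType) (u : R) : Prop :=
  exists v : R, u * v = 1 /\ v * u = 1.

Definition central (A : nzRingType) (a : A) : Prop :=
  forall b : A, a * b = b * a.

(* Z<X_1, ..., X_m>: the monoid algebra over int of the free monoid on 'I_m. *)
Definition ncpoly (m : nat) := {malg int[{fmonom 'I_m}]}.

Definition ncmonom_eval (A : nzRingType) (m : nat) (a : 'I_m -> A)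
    (w : {fmonom 'I_m}) : A :=
  \prod_(i <- (w : seq 'I_m)) a i.

Definition ncpoly_eval (A : nzRingType) (m : nat) (a : 'I_m -> A)
    (f : ncpoly m) : A :=
  mmap (fun z : int => z%:~R) (ncmonom_eval a) f.

Definition ncpoly_monic (m : nat) (f : ncpoly m) : Prop :=
  exists w : {fmonom 'I_m},
    mcoeff w f = 1 /\
    (forall w' : {fmonom 'I_m}, mcoeff w' f != 0 -> (fdeg w' <= fdeg w)%N).

Definition PI_property (A : nzRingType) : Prop :=
  exists (m : nat) (f : ncpoly m),
    ncpoly_monic f /\ (forall a : 'I_m -> A, ncpoly_eval a f = 0).

(* The inclusion of R in A is a ring morphism iota, through which A is a left
   R-module; the family b is indexed, so freeness makes its members distinct. *)
Definition left_basis (R A : nzRingType) (iota : R -> A) (I : eqType)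
    (b : I -> A) : Prop :=
  (forall a : A, exists (s : seq I) (c : I -> R),
     a = \sum_(i <- s) iota (c i) * b i) /\
  (forall (s : seq I) (c : I -> R), uniq s ->
     \sum_(i <- s) iota (c i) * b i = 0 -> forall i, i \in s -> c i = 0).

(* The product is taken in increasing order of the indices. *)
Definition std_monom (A : nzRingType) (n : nat) (x : 'I_n -> A)
    (alpha : {ffun 'I_n -> nat}) : A :=
  \prod_(i < n) x i ^+ alpha i.

Definition quadratic_relation (R A : nzRingType) (iota : R -> A) (n : nat)
    (x : 'I_n -> A) (i j : 'I_n) (c : R) : Prop :=
  exists (r0 : R) (r : 'I_n -> R),
    x j * x i - iota c * (x i * x j) = iota r0 + \sum_(k < n) iota (r k) * x k.

Record skew_PBW (R A : nzRingType) (iota : {rmorphism R -> A}) (n : nat)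
    (x : 'I_n -> A) : Prop := SkewPBW {
  skew_PBW_subring : injective iota;
  skew_PBW_basis : left_basis iota (std_monom x);
  skew_PBW_coef : forall (i : 'I_n) (r : R), r != 0 ->
    exists c : R, c != 0 /\
      exists d : R, x i * iota r - iota c * x i = iota d;
  skew_PBW_quad : forall i j : 'I_n,
    exists c : R, c != 0 /\ quadratic_relation iota x i j c
}.

Definition sigma_derivation (R : nzRingType) (sigma : R -> R)
    (delta : {additive R -> R}) : Prop :=
  forall r s : R, delta (r * s) = sigma r * delta s + delta r * s.

(* By freeness, sigma_i and delta_i are determined by the commutation rule,
   and so is c_{i,j} for i < j by its quadratic relation; hence asking for one
   bijective sigma_i (one invertible c_{i,j}) constrains the only one. *)
Record bijective_skew_PBW (R A : nzRingType) (iota : {rmorphism R -> A})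
    (n : nat) (x : 'I_n -> A) : Prop := BijectiveSkewPBW {
  bij_skew_PBW : skew_PBW iota x;
  bij_skew_PBW_sigma : forall i : 'I_n,
    exists (sigma : {rmorphism R -> R}) (delta : {additive R -> R}),
      [/\ sigma_derivation sigma delta,
          forall r : R, x i * iota r = iota (sigma r) * x i + iota (delta r)
        & bijective sigma];
  bij_skew_PBW_unit : forall i j : 'I_n, (i < j)%N ->
    exists c : R, invertible c /\ quadratic_relation iota x i j c
}.

(* Z(A) = k, where k sits in A through k -> R -> A. *)
Definition trivial_center (k : fieldType) (R : algType k) (A : nzRingType)
    (iota : R -> A) : Prop :=
  forall a : A, central a <-> exists c : k, a = iota c%:A.

(* Main.v *)
From HB Require Import structures.
Require Import Defs.
From mathcomp Require Import all_boot all_order all_algebra.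
From mathcomp Require Import perm fingroup.
From mathcomp Require Import finmap monalg.
From Stdlib Require Import Classical ClassicalEpsilon.

Set Implicit Arguments.
Unset Strict Implicit.
Unset Printing Implicit Defensive.

Import GRing.Theory.
Local Open Scope ring_scope.

(** Why the theorem is true.  A prime PI ring whose centre is a field k is
    finite-dimensional over k, whereas the powers of x_0 are linearly
    independent over k because they belong to a left basis of A over R.  So
    Z(A) cannot be k once A is known to be prime.

    Primeness of A ([skew_PBW_prime]) is a leading-term argument.  Modulo
    terms of lower degree the generators commute with each other up to
    invertible coefficients, and with scalars up to the bijections sigma_i.
    Hence the leading coefficient of f r g is a sigma(r) sigma(b) c, with a and
    b the leading coefficients of f and g and c invertible; as r runs over R,
    so does sigma(r), and primeness of R applies.

    Finite dimension ([prime_PI_finite_dim]) is the part that uses the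
    polynomial identity.  Let the operators y |-> sum_s a_s y b_s act on A.

    - Regev's theorem, in the case that is needed: these operators satisfy a
      nontrivial multilinear identity ([operator_identity]).  If A satisfies a
      multilinear identity of degree D + 1, then the n! monomials a_w, w a
      permutation of 0, ..., n - 1, are integral combinations of those for
      which w has no decreasing subsequence of length D + 1
      ([good_words_span]).  There are at most D^(2n) such w
      ([card_good_words]).  The same bound holds in the converse ring, so the
      n! expressions a_w y b_w span a space of dimension at most D^(4n) < n!
      for large n, and a linear relation exists.

    - A staircase of operators s_i with s_i w_i = w_(i+1) and s_i w_j = 0 for
      j < i isolates one term of such an identity, hence has bounded length.
      Therefore every nonzero ideal contains a finite family u on which no
      nonzero operator vanishes ([exists_separating]).  For a family of
      minimal size there are operators e_i with e_i u_j = delta_ij d and d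
      nonzero ([exists_dual_family]): the u_i behave as a basis, and the e_i
      as its coordinate functions multiplied by d.

    - Over the extended centroid, 1 is a combination of a second such family,
      chosen inside the ideal of d.  Clearing the denominators of its
      coefficients turns e_0, an operator with values in the line spanned by
      d, into an operator with central values; one of these values is a
      nonzero central element of the ideal of d ([exists_central_in_ideal]).
      If the centre is a field, that ideal contains 1, the e_i can be
      normalized to e_i u_j = delta_ij, their values are then central, and the
      u_i span A over k. *)

(** * Words without long decreasing subsequences *)

(** One less than the length of the longest decreasing subsequence of w that
    starts at the letter v, for w without repetition. *)
Fixpoint declen (w : seq nat) (v : nat) : nat :=
  if w is x :: s then
    if v == x then (\max_(y <- s | (y < x)%N) (declen s y).+1)%N else declen s v
  else 0%N.

Definition good_word (D : nat) (w : seq nat) : bool :=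
  all (fun v => (declen w v < D)%N) w.

Lemma declen_cons_notin x s v : v \in s -> x \notin s ->
  declen (x :: s) v = declen s v.
Proof. by move=> vs xs /=; case: eqP => // vx; rewrite vx (negbTE xs) in vs. Qed.

(** If y were smaller than x, a decreasing subsequence starting at y could be
    prolonged by x, so the two lengths would differ. *)
Lemma declen_inc x s y : uniq (x :: s) -> y \in s ->
  declen (x :: s) y = declen (x :: s) x -> (x < y)%N.
Proof.
move=> /andP[xs us] ys; rewrite (declen_cons_notin ys xs) /= eqxx => e.
rewrite ltnNge leq_eqVlt; apply/negP => /orP[/eqP yx|yx].
  by rewrite yx (negbTE xs) in ys.
have := @leq_bigmax_seq _ s (fun y => (y < x)%N) (fun y => (declen s y).+1) y ys yx.
by rewrite -e ltnn.
Qed.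

(** Letters with the same [declen] appear in increasing order.  So the first
    letter of w is the least letter having the [declen] of the first position;
    knowing [declen] both by position and by letter determines w, from left
    to right. *)
Lemma declen_inj w w' : uniq w -> uniq w' -> perm_eq w w' ->
  [seq declen w v | v <- w] = [seq declen w' v | v <- w'] ->
  {in w, declen w =1 declen w'} -> w = w'.
Proof.
elim: w w' => [|x s IH] [|x' s'] // uw uw'; try by move/perm_size.
move=> pw ew lw.
have [xs us] := andP uw; have [xs' us'] := andP uw'.
have exx : x = x'.
  apply/eqP; apply/negPn/negP => nxx.
  have x's : x' \in s.
    have : x' \in x :: s by rewrite (perm_mem pw) mem_head.
    by rewrite inE eq_sym (negbTE nxx).
  have xs2 : x \in s'.
    have : x \in x' :: s' by rewrite -(perm_mem pw) mem_head.
    by rewrite inE (negbTE nxx).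
  have h : declen (x :: s) x = declen (x' :: s') x' by case: ew.
  have l1 : (x < x')%N.
    apply: (declen_inc uw x's); rewrite h; apply: lw.
    by rewrite inE x's orbT.
  have l2 : (x' < x)%N.
    by apply: (declen_inc uw' xs2); rewrite -h; symmetry; apply: lw; exact: mem_head.
  by move: (ltn_trans l1 l2); rewrite ltnn.
subst x'; congr (_ :: _); apply: IH => //.
- by move: pw; rewrite perm_cons.
- move: ew => [_ ew].
  have e1 : [seq declen s v | v <- s] = [seq declen (x :: s) v | v <- s].
    by apply/eq_in_map => v vs; rewrite declen_cons_notin.
  have e2 : [seq declen s' v | v <- s'] = [seq declen (x :: s') v | v <- s'].
    by apply/eq_in_map => v vs; rewrite declen_cons_notin.
  by rewrite e1 e2.
- move=> v vs; rewrite -(declen_cons_notin vs xs) lw ?inE ?vs ?orbT //.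
  by rewrite declen_cons_notin // -(perm_mem (_ : perm_eq s s')) //; move: pw; rewrite perm_cons.
Qed.

(** By [declen_inj], a good word is encoded by two functions from n to D. *)
Lemma card_good_words D n :
  (size [seq w <- permutations (iota 0 n) | good_word D w] <= D ^ n * D ^ n)%N.
Proof.
(* For D = 0 only the empty word is good, and the powers of 0 agree. *)
case: D => [|D].
  case: n => [|n] //; rewrite exp0n // leqn0 size_eq0; apply/eqP.
  rewrite (eq_in_filter (a2 := pred0)) ?filter_pred0 // => w.
  rewrite mem_permutations => /perm_size; rewrite size_iota.
  by case: w => //= x s _; rewrite ltn0.
set G := filter _ _.
have GP w : w \in G -> [/\ perm_eq w (iota 0 n), uniq w & good_word D.+1 w].
  rewrite mem_filter mem_permutations => /andP[gw pw]; split => //.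
  by rewrite (perm_uniq pw) iota_uniq.
(* [declen] by position, then by letter. *)
pose key (w : seq nat) : n.-tuple 'I_D.+1 * n.-tuple 'I_D.+1 :=
  ([tuple inord (declen w (nth 0%N w i)) | i < n], [tuple inord (declen w i) | i < n]).
have kinj : {in G &, injective key}.
  move=> w w' /GP[pw uw gw] /GP[pw' uw' gw'] e.
  have sw : size w = n by rewrite (perm_size pw) size_iota.
  have sw' : size w' = n by rewrite (perm_size pw') size_iota.
  have bw v : v \in w -> (declen w v < D.+1)%N by move/allP: gw => /(_ v).
  have bw' v : v \in w' -> (declen w' v < D.+1)%N by move/allP: gw' => /(_ v).
  apply: declen_inj => //.
  - by rewrite (permPl pw) perm_sym.
  - apply: (@eq_from_nth _ 0%N); first by rewrite !size_map sw sw'.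
    move=> i; rewrite size_map sw => li; rewrite !(nth_map 0%N) ?sw ?sw' //.
    have := congr1 (fun t => val (tnth t.1 (Ordinal li))) e.
    rewrite /= !tnth_mktuple /=; rewrite !inordK //; [apply: bw'|apply: bw];
      by apply: mem_nth; rewrite ?sw ?sw'.
  - move=> v vw.
    have li : (v < n)%N by move: vw; rewrite (perm_mem pw) mem_iota.
    have := congr1 (fun t => val (tnth t.2 (Ordinal li))) e.
    rewrite /= !tnth_mktuple /=; rewrite !inordK //; [apply: bw'|apply: bw] => //.
    by rewrite (perm_mem pw') -(perm_mem pw).
have uG : uniq (map key G).
  by rewrite map_inj_in_uniq // filter_uniq // permutations_uniq.
rewrite -(size_map key) -(card_uniqP uG).
by apply: leq_trans (max_card _) _; rewrite card_prod !card_tuple card_ord.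
Qed.
(** Unlike in [big_enum], the operation need not be commutative. *)
Lemma big_enum_ord (R : Type) (idx : R) op n (F : 'I_n -> R) :
  \big[op/idx]_(i <- enum 'I_n) F i = \big[op/idx]_(i < n) F i.
Proof. by rewrite enumT [index_enum _]unlock. Qed.

(** A list of nonempty words, each kept with its first letter apart: the
    first letters decide the lexicographic comparisons below. *)
Definition glue (vs : seq (nat * seq nat)) : seq nat :=
  flatten [seq p.1 :: p.2 | p <- vs].

Lemma glue_cons p vs : glue (p :: vs) = (p.1 :: p.2) ++ glue vs.
Proof. by []. Qed.

(** Cutting w at the letters of a decreasing subsequence gives blocks whose
    first letters decrease. *)
Lemma bad_word_split D w v : v \in w -> (D <= declen w v)%N ->
  exists u t vs, [/\ w = u ++ glue ((v, t) :: vs), size vs = D &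
    path (fun p q => (q.1 < p.1)%N) (v, t) vs].
Proof.
elim: w D v => // x s IH D v vw.
have [->|nvx] := eqVneq v x; last first.
  move: vw => /=; rewrite inE (negbTE nvx) /= => vs lD.
  have [u [t [vs' [e1 e2 e3]]]] := IH _ _ vs lD.
  by exists (x :: u), t, vs'; rewrite e1.
rewrite /= eqxx; case: D => [_|D lD].
  by exists [::], s, [::]; rewrite /glue /= cats0.
have [y ys [yx lDy]] : exists2 y, y \in s & (y < x)%N /\ (D <= declen s y)%N.
  apply: NNPP => nex; move: lD; rewrite ltnNge => /negP; apply.
  apply/bigmax_leqP_seq => y ys yx; rewrite ltnNge; apply/negP => lDy.
  by apply: nex; exists y.
have [u [t [vs' [e1 e2 e3]]]] := IH _ _ ys lDy.
exists [::], u, ((y, t) :: vs'); split; rewrite /= ?e2 //.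
  by rewrite e1.
by rewrite yx.
Qed.

(** Reading words as numerals in base B turns the lexicographic order on words
    of a given length, with letters below B, into the order of nat, on which induction is direct. *)
Fixpoint numeral (B : nat) (w : seq nat) : nat :=
  if w is x :: s then (x * B ^ size s + numeral B s)%N else 0%N.

Lemma numeral_lt B w : all (fun v => (v < B)%N) w -> (numeral B w < B ^ size w)%N.
Proof.
elim: w => //= x s IH /andP[xB /IH sB]; rewrite expnS.
apply: (@leq_trans (x.+1 * B ^ size s)); last by rewrite leq_mul2r xB orbT.
by rewrite mulSn addnC ltn_add2r.
Qed.

Lemma numeral_cat B u w : numeral B (u ++ w) = (numeral B u * B ^ size w + numeral B w)%N.
Proof.
elim: u => //= x u ->; rewrite size_cat expnD mulnDl mulnA addnA; congr (_ + _)%N.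
Qed.

(** Blocks whose first letters decrease are in the lexicographically largest
    order: at the first place where another order differs, it has a smaller
    first letter. *)
Lemma numeral_glue B vs vs' : sorted (fun p q => (q.1 < p.1)%N) vs ->
  perm_eq vs' vs -> vs' <> vs -> all (fun v => (v < B)%N) (glue vs) ->
  (numeral B (glue vs') < numeral B (glue vs))%N.
Proof.
elim: vs vs' => [|p r IH] [|q r'] // so pe ne al; try by have := perm_size pe.
have pg : perm_eq (glue (q :: r')) (glue (p :: r)).
  by apply: perm_flatten; apply: perm_map.
have [eqp|nqp] := eqVneq q p.
  subst q.
  have pe' : perm_eq r' r by move: pe; rewrite perm_cons.
  have sz : size (glue r') = size (glue r).
    by apply: perm_size; apply: perm_flatten; apply: perm_map.
  rewrite !glue_cons !numeral_cat sz ltn_add2l; apply: IH => //.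
  - exact: path_sorted so.
  - by move=> e; apply: ne; rewrite e.
  - by move: al; rewrite /glue /= all_cat => /and3P[].
have qr : q \in r.
  have : q \in p :: r by rewrite -(perm_mem pe) mem_head.
  by rewrite inE (negbTE nqp).
have lt : (q.1 < p.1)%N.
  have tr : transitive (fun p q : nat * seq nat => (q.1 < p.1)%N).
    by move=> a b c h1 h2; apply: ltn_trans h2 h1.
  by move: so => /= /(order_path_min tr) /allP /(_ _ qr).
have sz := perm_size pg; have al' : all (fun v => (v < B)%N) (glue (q :: r')).
  by rewrite (perm_all _ pg).
move: sz al'; rewrite /glue /= => -[sz] /andP[_ al'].
apply: (@leq_trans (q.1.+1 * B ^ size (q.2 ++ glue r'))).
  by rewrite mulSn addnC ltn_add2r numeral_lt.
by rewrite sz (leq_trans _ (leq_addr _ _)) // leq_mul2r lt orbT.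
Qed.

Definition multilinear_identity (B : nzRingType) (D : nat) (beta : 'S_D -> int) :=
  forall y : 'I_D -> B, \sum_(p : 'S_D) (\prod_(i < D) y (p i)) *~ beta p = 0.

Definition word_eval (B : nzRingType) (a : nat -> B) (w : seq nat) : B :=
  \prod_(i <- w) a i.

Lemma word_eval_glue (B : nzRingType) (a : nat -> B) vs :
  word_eval a (glue vs) = \prod_(p <- vs) word_eval a (p.1 :: p.2).
Proof. by rewrite /word_eval /glue big_flatten big_map. Qed.

(** Latyshev's straightening.  A word which is not good is a product of D + 1
    blocks in lexicographically decreasing order, preceded by a prefix.  The
    identity, applied to these blocks, rewrites the word as a combination of
    lexicographically smaller ones.  The coefficients do not depend on the
    values of the letters. *)
Lemma good_words_span (B : nzRingType) D (beta : 'S_D.+1 -> int) n (w : seq nat) :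
  multilinear_identity B beta -> beta 1%g = 1 -> perm_eq w (iota 0 n) ->
  exists c : seq nat -> int, forall a : nat -> B,
    word_eval a w =
      \sum_(g <- permutations (iota 0 n) | good_word D g) word_eval a g *~ c g.
Proof.
move=> idB b1; have [m] := ubnP (numeral n w); elim: m w => // m IH w wm pw.
have [gw|/allPn[v vw]] := boolP (good_word D w).
  exists (fun g => (g == w)%:Z) => a.
  rewrite -big_filter (bigD1_seq w) /=; last 2 first.
  - by rewrite mem_filter gw mem_permutations.
  - by rewrite filter_uniq // permutations_uniq.
  rewrite eqxx big1 ?addr0 // => g /negbTE ->; by rewrite mulr0z.
rewrite -leqNgt => lv.
have [u [vs [ew st pvs]]] : exists u vs, [/\ w = u ++ glue vs,
    size vs == D.+1 & sorted (fun p q => (q.1 < p.1)%N) vs].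
  have [u [t [vs [ew svs pvs]]]] := bad_word_split vw lv.
  by exists u, ((v, t) :: vs); split; rewrite //= svs.
pose T := Tuple st.
pose wp (p : 'S_D.+1) := u ++ glue [tuple tnth T (p i) | i < D.+1].
have pwp p : perm_eq (wp p) (iota 0 n).
  apply: perm_trans pw; rewrite ew perm_cat2l /glue; apply: perm_flatten.
  apply: perm_map; change (perm_eq [tuple tnth T (p i) | i < D.+1] T).
  by apply/tuple_permP; exists p.
have alw (z : seq nat) : perm_eq z (iota 0 n) -> all (fun v => (v < n)%N) z.
  by move=> pz; apply/allP => k; rewrite (perm_mem pz) mem_iota.
have uT : uniq T.
  apply: (@sorted_uniq _ (fun p q => (q.1 < p.1)%N)) => //.
  - by move=> a b c h1 h2; apply: ltn_trans h2 h1.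
  - by move=> a; rewrite /= ltnn.
(* The identity permutation gives back w; all the other ones descend. *)
have lwp p : p != 1%g -> (numeral n (wp p) < m)%N.
  move=> p1; rewrite ltnS in wm; apply: leq_trans wm; rewrite ew /wp !numeral_cat.
  have pp : perm_eq [tuple tnth T (p i) | i < D.+1] T by apply/tuple_permP; exists p.
  have -> : size (glue [tuple tnth T (p i) | i < D.+1]) = size (glue T).
    by apply: perm_size; apply: perm_flatten; apply: perm_map.
  rewrite ltn_add2l; apply: (@numeral_glue n T) => //.
    move=> e; move/eqP: p1; apply; apply/permP => i; rewrite perm1.
    have /tuple_uniqP := uT; apply.
    by rewrite -[in RHS](_ : [tuple tnth T (p i) | i < D.+1] = T) ?tnth_mktuple //; apply: val_inj.
  by move: (alw _ pw); rewrite ew all_cat => /andP[].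
have /fin_all_exists[c cP] : forall p, exists c : seq nat -> int,
    p != 1%g -> forall a : nat -> B, word_eval a (wp p) =
      \sum_(g <- permutations (iota 0 n) | good_word D g) word_eval a g *~ c g.
  move=> p; have [->|p1] := eqVneq p 1%g; first by exists (fun=> 0).
  by have [c cP] := IH _ (lwp _ p1) (pwp p); exists c.
exists (fun g => - \sum_(p | p != 1%g) c p g * beta p) => a.
have evp p : word_eval a (wp p) =
    word_eval a u * \prod_(i < D.+1) word_eval a ((tnth T (p i)).1 :: (tnth T (p i)).2).
  rewrite /wp /word_eval big_cat /=; congr (_ * _).
  by rewrite -/(word_eval _ _) word_eval_glue /= big_map big_enum_ord.
have := congr1 (fun z => word_eval a u * z)
  (idB (fun i => word_eval a ((tnth T i).1 :: (tnth T i).2))).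
rewrite mulr0 mulr_sumr (eq_bigr (fun p => word_eval a (wp p) *~ beta p)); last first.
  by move=> p _; rewrite evp mulrzAr.
rewrite (bigD1 1%g) //= b1 mulr1z => /eqP; rewrite addr_eq0 => /eqP.
have -> : wp 1%g = w.
  rewrite /wp ew; congr (_ ++ glue _).
  rewrite -[RHS]/(val T); congr val; apply: eq_from_tnth => i.
  by rewrite tnth_mktuple perm1.
move=> ->; rewrite (eq_bigr (fun p => \sum_(g <- permutations (iota 0 n) | good_word D g) word_eval a g *~ (c p g * beta p))); last first.
  move=> p p1; rewrite cP // mulrz_suml; apply: eq_bigr => g _.
  by rewrite mulrzA.
rewrite exchange_big /= -sumrN; apply: eq_bigr => g _.
by rewrite mulrNz mulrz_sumr.
Qed.

(** * From a monic identity to a multilinear one *)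

(** Adding or removing a point outside X pairs off supersets of opposite
    signs. *)
Lemma sum_sign_supersets (I : finType) (X : {set I}) :
  \sum_(S : {set I} | X \subset S) (-1) ^+ #|S| =
    (if X == setT then (-1) ^+ #|I| else 0) :> int.
Proof.
case: eqP => [->|/eqP nX].
  rewrite (big_pred1 setT) ?cardsT // => S.
  by rewrite subTset.
have [x xX] : exists x, x \notin X.
  apply/existsP; rewrite -negb_forall; apply: contra nX => /forallP h.
  by apply/eqP/setP => x; rewrite inE h.
rewrite (bigID (fun S : {set I} => x \in S)) /=.
rewrite (reindex_onto (fun S => x |: S) (fun S => S :\ x)) /=; last first.
  by move=> S /andP[_ xS]; rewrite setD1K.
rewrite (eq_bigl (fun S : {set I} => (X \subset S) && (x \notin S))); last first.
  move=> S; rewrite setU11 andbT; apply/andP/andP => -[h1 h2].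
    have xS : x \notin S by rewrite -(eqP h2) setD11.
    split=> //; apply/subsetP => z zX; move: (subsetP h1 z zX).
    by rewrite in_setU1 => /orP[/eqP zx|//]; rewrite -zx zX in xX.
  by rewrite setU1K // eqxx; split=> //; apply: subset_trans h1 (subsetUr _ _).
rewrite -big_split /= big1 // => S /andP[_ xS].
by rewrite cardsU1 xS exprS mulN1r addNr.
Qed.

Lemma sum_injective_ffun (V : nmodType) D (F : {ffun 'I_D -> 'I_D} -> V) :
  \sum_(h : {ffun 'I_D -> 'I_D} | injectiveb h) F h = \sum_(p : 'S_D) F (val p).
Proof.
rewrite (reindex_onto val (insubd (1%g : 'S_D))) /=; last first.
  by move=> h ih; rewrite insubdK.
by apply: eq_bigl => p; rewrite valKd eqxx andbT (valP p).
Qed.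

(** Inclusion-exclusion: in the monomial u, each variable i is replaced by the
    sum of the y_j over the positions j of i in w that belong to S.  The
    alternating sum over S keeps the products that involve all the y_j. *)
Lemma polarize_monomial (A : nzRingType) m D l (w : D.-tuple 'I_m)
    (u : l.-tuple 'I_m) (y : 'I_D -> A) :
  \sum_(S : {set 'I_D})
     (\prod_(i <- u) \sum_(j | (j \in S) && (tnth w j == i)) y j) *~ (-1) ^+ #|S| =
  \sum_(h : {ffun 'I_l -> 'I_D} | [forall t, tnth w (h t) == tnth u t]
        && ([set h t | t in 'I_l] == setT))
     (\prod_(t < l) y (h t)) *~ (-1) ^+ D.
Proof.
transitivity (\sum_(S : {set 'I_D}) \sum_(h : {ffun 'I_l -> 'I_D} |
     [forall t, tnth w (h t) == tnth u t] && ([set h t | t in 'I_l] \subset S))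
     (\prod_(t < l) y (h t)) *~ (-1) ^+ #|S|).
  apply: eq_bigr => S _; rewrite big_tuple bigA_distr_big_dep mulrz_suml.
  apply: eq_bigl => h; apply/familyP/andP => [hh|[/forallP h1 /subsetP h2] t].
    split; first by apply/forallP => t; have := hh t; rewrite unfold_in => /andP[].
    by apply/subsetP => z /imsetP[t _ ->]; have := hh t; rewrite unfold_in => /andP[].
  by rewrite unfold_in h1 h2 // imset_f.
rewrite (exchange_big_dep (fun h : {ffun 'I_l -> 'I_D} => [forall t, tnth w (h t) == tnth u t])) /=; last first.
  by move=> S h _ /andP[].
rewrite [RHS]big_mkcondr /=; apply: eq_bigr => h hw.
rewrite -mulrz_sumr (eq_bigl (fun S : {set 'I_D} => [set h t | t in 'I_l] \subset S)); last first.
  by move=> S; rewrite hw.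
by rewrite sum_sign_supersets card_ord; case: eqP; rewrite ?mulr0z.
Qed.

(** When u is at most as long as w, a surjection from the positions of u onto
    those of w is a permutation, and u is the corresponding rearrangement of
    w. *)
Lemma polarize_word (A : nzRingType) m D (w : D.-tuple 'I_m) (u : seq 'I_m)
    (y : 'I_D -> A) : (size u <= D)%N ->
  \sum_(S : {set 'I_D})
     (\prod_(i <- u) \sum_(j | (j \in S) && (tnth w j == i)) y j) *~ (-1) ^+ #|S| =
  \sum_(p : 'S_D | val [tuple tnth w (p i) | i < D] == u)
     (\prod_(i < D) y (p i)) *~ (-1) ^+ D.
Proof.
rewrite leq_eqVlt => /orP[su|su]; last first.
  rewrite (polarize_monomial w (in_tuple u)) !big1 //.
    by move=> p /eqP e; move: su; rewrite -e size_tuple ltnn.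
  move=> h /andP[_ /eqP sh]; have := leq_imset_card h 'I_(size u).
  by rewrite sh cardsT !card_ord leqNgt su.
rewrite (polarize_monomial w (Tuple su)).
transitivity (\sum_(h : {ffun 'I_D -> 'I_D} | injectiveb h)
   (if [forall t, tnth w (h t) == tnth (Tuple su) t]
    then (\prod_(t < D) y (h t)) *~ (-1) ^+ D else 0)).
  rewrite -big_mkcondr; apply: eq_bigl => h; rewrite andbC; congr (_ && _).
  apply/eqP/injectiveP => [e|inj].
    by apply: in2T; apply/imset_injP; rewrite e cardsT.
  by apply/setP => z; rewrite inE; apply/imsetP; exists (invF inj z); rewrite ?f_invF.
rewrite sum_injective_ffun [RHS]big_mkcond /=; apply: eq_bigr => p _.
have -> : [forall t, tnth w ((val p) t) == tnth (Tuple su) t] =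
    (val [tuple tnth w (p i) | i < D] == u).
  rewrite -[u]/(val (Tuple su)) (inj_eq val_inj).
  apply/forallP/eqP => [h|h t]; last by rewrite -h tnth_mktuple pvalE.
  by apply: eq_from_tnth => t; rewrite tnth_mktuple -(eqP (h t)) pvalE.
by case: ifP => // _; congr (_ *~ _); apply: eq_bigr => i _; rewrite pvalE.
Qed.

(** Polarizing f along its leading monomial w gives an identity in which y_p
    has the coefficient in f of the monomial w permuted by p; for p = 1 this is
    the leading coefficient. *)
Lemma PI_multilinear (A : nzRingType) : PI_property A ->
  exists D (beta : 'S_D -> int), beta 1%g = 1 /\ multilinear_identity A beta.
Proof.
move=> [m [f [[w [fw wmax]] f0]]].
pose D := size w; pose wt := in_tuple w : D.-tuple 'I_m.
pose wp (p : 'S_D) : {fmonom 'I_m} := FMonom [tuple tnth wt (p i) | i < D].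
exists D, (fun p => mcoeff (wp p) f); split.
  rewrite -fw; congr mcoeff; apply: val_inj => /=.
  transitivity (val wt); last by [].
  rewrite -[LHS]/(val [tuple tnth wt ((1%g : 'S_D) i) | i < D]).
  by congr val; apply: eq_from_tnth => i; rewrite tnth_mktuple perm1.
move=> y.
pose a (S : {set 'I_D}) i := \sum_(j | (j \in S) && (tnth wt j == i)) y j.
have h0 : \sum_(S : {set 'I_D}) ncpoly_eval (a S) f *~ (-1) ^+ #|S| = 0.
  by apply: big1 => S _; rewrite f0 mul0rz.
suff h : \sum_(S : {set 'I_D}) ncpoly_eval (a S) f *~ (-1) ^+ #|S| =
   (\sum_(p : 'S_D) (\prod_(i < D) y (p i)) *~ mcoeff (wp p) f) *~ (-1) ^+ D.
  move: h; rewrite h0 => /(congr1 (fun z => z *~ (-1) ^+ D)).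
  by rewrite mul0rz -mulrzA -exprD addnn -mul2n exprM sqrrN !expr1n mulr1z.
transitivity (\sum_(u <- msupp f) (mcoeff u f)%:~R *
   \sum_(p | wp p == u) (\prod_(i < D) y (p i)) *~ (-1) ^+ D).
  under eq_bigr => S _ do rewrite /ncpoly_eval mmapE mulrz_suml.
  rewrite exchange_big /= big_seq [RHS]big_seq; apply: eq_bigr => u uf.
  under eq_bigr => S _ do rewrite -mulrzAr.
  rewrite -mulr_sumr /ncmonom_eval polarize_word //.
  by apply: (wmax u); rewrite mcoeff_neq0.
under eq_bigr => u _ do rewrite mulr_sumr.
rewrite (exchange_big_dep predT) //= mulrz_suml; apply: eq_bigr => p _.
rewrite -mulrzA mulrC mulrzA.
rewrite -big_filter; have [pf|npf] := boolP (wp p \in msupp f).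
  rewrite (bigD1_seq (wp p)) ?mem_filter ?eqxx ?filter_uniq ?fset_uniq //=.
  rewrite [X in _ + X]big1_seq ?addr0 => [|u /andP[nu]]; last first.
    by rewrite mem_filter => /andP[/eqP e _]; rewrite e eqxx in nu.
  by rewrite mulrzl.
rewrite [LHS]big1_seq; last first.
  by move=> u /andP[_]; rewrite mem_filter => /andP[/eqP <-]; rewrite (negbTE npf).
by rewrite (mcoeff_outdom npf) mulr0z.
Qed.

(** * A multilinear identity for multiplication operators *)
Lemma exp_lt_fact L : exists n, (L ^ n < n`!)%N.
Proof.
have h m j : (m.+1 ^ j * m`! <= (m + j)`!)%N.
  elim: j => [|j IH]; first by rewrite expn0 mul1n addn0.
  rewrite addnS factS expnS -mulnA leq_mul //; first by rewrite ltnS leq_addr.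
case: L => [|L]; first by exists 1%N.
(* With m = 2M and j = M m, (m + j)! >= (m + 1)^j > 2^j M^j >= M^m M^j. *)
pose M := L.+1; pose m := (2 * M)%N; pose j := (M * m)%N.
exists (m + j)%N; apply: leq_trans (h m j).
apply: (@leq_trans (m.+1 ^ j)); last by rewrite leq_pmulr // fact_gt0.
apply: (@leq_ltn_trans (m ^ j)); last by rewrite ltn_exp2r // /j muln_gt0 /m muln_gt0.
rewrite expnD [in X in (_ <= X)%N]/m expnMn leq_mul //.
by rewrite /j expnM leq_exp2r ?muln_gt0 // ltnW // ltn_expl.
Qed.

Lemma kernel_vector (k : fieldType) (I J : finType) (M : I -> J -> k) :
  (#|J| < #|I|)%N ->
  exists alpha : I -> k, (exists i, alpha i != 0) /\
    forall j, \sum_i alpha i * M i j = 0.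
Proof.
move=> lt; pose X := \matrix_(i < #|I|, j < #|J|) M (enum_val i) (enum_val j).
have : kermx X != 0.
  rewrite kermx_eq0 /row_free; apply: contraTneq lt => e.
  by rewrite -leqNgt -[X in (X <= _)%N]e rank_leq_col.
case/rowV0Pn => v; rewrite sub_kermx => /eqP vX v0.
exists (fun i => v 0 (enum_rank i)); split.
  apply: NNPP => nex; move/eqP: v0; apply; apply/rowP => i; rewrite mxE.
  apply/eqP/negPn/negP => vi; apply: nex; exists (enum_val i).
  by rewrite enum_valK.
move=> j; have := congr1 (fun z : 'rV_(#|J|) => z 0 (enum_rank j)) vX.
rewrite !mxE => vXj; rewrite -[RHS]vXj (reindex_onto enum_val enum_rank) /=; last first.
  by move=> i _; rewrite enum_rankK.
rewrite (eq_bigl predT); last by move=> i; rewrite enum_valK eqxx.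
by apply: eq_bigr => i _; rewrite !mxE enum_valK enum_rankK.
Qed.

Lemma word_eval_converse (A : nzRingType) (b : nat -> A) w :
  word_eval (b : nat -> A^c) w = word_eval b (rev w).
Proof. exact: rev_prodr. Qed.

(** Products in the converse ring are products in the reverse order: the
    identity is conjugated by the reversal r of the indices, which keeps the
    coefficient of the identity permutation equal to 1. *)
Lemma multilinear_identity_converse (A : nzRingType) D (beta : 'S_D -> int) :
  beta 1%g = 1 -> multilinear_identity A beta ->
  exists beta' : 'S_D -> int, beta' 1%g = 1 /\ multilinear_identity A^c beta'.
Proof.
move=> b1 idA; pose r : 'S_D := perm (@rev_ord_inj D).
exists (fun p => beta (r * p * r)%g); split.
  rewrite mulg1 -b1; congr beta; apply/permP => i.
  by rewrite permM !permE rev_ordK.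
move=> y; rewrite (reindex_inj (mulIg r)) (reindex_inj (mulgI r)) /=.
rewrite -[RHS](idA (fun i => y (r i))); apply: eq_bigr => p _.
have rE i : val (r i) = (D - i.+1)%N by rewrite permE.
have rr : (r * r = 1)%g by apply/permP => i; rewrite permM !permE rev_ordK.
have -> : (r * (r * p * r) * r = p)%g.
  by rewrite !mulgA rr mul1g -mulgA rr mulg1.
congr (_ *~ _); rewrite -[LHS]big_enum_ord rev_prodr.
rewrite -[RHS]big_enum_ord.
have er : enum 'I_D = [seq r i | i <- rev (enum 'I_D)].
  apply: (inj_map val_inj); rewrite [LHS](val_enum_ord D) -map_comp map_rev.
  apply: (@eq_from_nth _ 0%N); first by rewrite size_iota size_rev size_map size_enum_ord.
  move=> i; rewrite size_iota => li; rewrite nth_iota // add0n.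
  have se : size [seq (val \o r) j | j <- enum 'I_D] = D by rewrite size_map size_enum_ord.
  rewrite nth_rev se //.
  have ld : (D - i.+1 < D)%N by rewrite ltn_subrL /= (leq_ltn_trans _ li).
  rewrite (nth_map (Ordinal li)) ?size_enum_ord // [(_ \o _) _]rE nth_enum_ord //.
  by rewrite subnSK // subKn // ltnW.
rewrite [in RHS]er big_map; apply: eq_bigr => i _; by rewrite !permM.
Qed.

Lemma mulrz_sandwich (A : nzRingType) (x y z : A) (m l : int) :
  x *~ m * y * (z *~ l) = (m * l)%:~R * (x * y * z).
Proof. by rewrite mulrzAl mulrzAl mulrzAr mulrzl -mulrzA [l * m]mulrC. Qed.

(** The monomials in a and those in b are both combinations of monomials
    indexed by good words, hence n! expressions lie in a span of D^(4n) < n!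
    of them; [kernel_vector] gives the relation.  Its coefficients are in k,
    although the identity of A has integral ones. *)
Lemma multiplication_identity (A : nzRingType) (k : fieldType)
    (phi : {rmorphism k -> A}) : PI_property A ->
  exists n (alpha : seq nat -> k),
    (exists2 w0, perm_eq w0 (iota 0 n) & alpha w0 != 0) /\
    forall (a b : nat -> A) y,
      \sum_(w <- permutations (iota 0 n))
         phi (alpha w) * (word_eval a w * y * word_eval b (rev w)) = 0.
Proof.
move=> /PI_multilinear [[|D] [beta [b1 idA]]].
  (* An identity of degree 0 says that 1 = 0. *)
  have := idA (fun=> 0); rewrite (big_pred1 1%g) => [|p]; last first.
    by symmetry; apply/eqP/permP; case.
  by rewrite b1 big_ord0 mulr1z => /eqP; rewrite oner_eq0.
have [beta' [b1' idA']] := multilinear_identity_converse b1 idA.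
have [n ltn] := exp_lt_fact (D ^ 2 * D ^ 2).
pose P := permutations (iota 0 n); pose G := [seq w <- P | good_word D w].
have sP : size P = n`! by rewrite size_permutations ?iota_uniq // size_iota.
have PP (i : 'I_(size P)) : perm_eq (nth [::] P i) (iota 0 n).
  by rewrite -mem_permutations mem_nth.
have /fin_all_exists[c cP] := fun i => good_words_span idA b1 (PP i).
have /fin_all_exists[c' cP'] := fun i => good_words_span idA' b1' (PP i).
have [] := @kernel_vector k 'I_(size P) ('I_(size G) * 'I_(size G))%type
  (fun i j => (c i (nth [::] G j.1) * c' i (nth [::] G j.2))%:~R).
  rewrite card_prod !card_ord sP; apply: leq_ltn_trans ltn.
  apply: leq_trans (leq_mul (card_good_words D n) (card_good_words D n)) _.
  by rewrite -!mulnn !expnMn.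
move=> alpha [[i0 ai0] aP].
exists n, (fun w => if insub (index w P) is Some i then alpha i else 0); split.
  exists (nth [::] P i0) => //.
  by rewrite index_uniq ?permutations_uniq // valK.
move=> a b y.
rewrite -/P (big_nth [::]) big_mkord.
have cP1 (i : 'I_(size P)) : word_eval a (nth [::] P i) =
    \sum_(g <- G) word_eval a g *~ c i g.
  by rewrite cP big_filter.
have cP2 (i : 'I_(size P)) : word_eval b (rev (nth [::] P i)) =
    \sum_(g <- G) word_eval b (rev g) *~ c' i g.
  by rewrite big_filter -word_eval_converse cP'; apply: eq_bigr => g _; rewrite word_eval_converse.
pose F (j : 'I_(size G) * 'I_(size G)) :=
  word_eval a (nth [::] G j.1) * y * word_eval b (rev (nth [::] G j.2)).
transitivity (\sum_(i < size P) \sum_(j : 'I_(size G) * 'I_(size G))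
    phi (alpha i * (c i (nth [::] G j.1) * c' i (nth [::] G j.2))%:~R) * F j).
  apply: eq_bigr => i _; rewrite index_uniq ?permutations_uniq // valK.
  rewrite cP1 cP2 !(big_nth [::]) !big_mkord.
  under [RHS]eq_bigr => j _ do rewrite rmorphM rmorph_int -mulrA.
  rewrite -mulr_sumr; congr (_ * _).
  rewrite mulr_suml mulr_suml; under eq_bigr => j _ do rewrite mulr_sumr.
  rewrite pair_bigA /=.
  apply: eq_bigr => -[j1 j2] _ /=; rewrite /F /=; exact: mulrz_sandwich.
rewrite exchange_big big1 //= => j _.
by rewrite -mulr_suml -rmorph_sum aP rmorph0 mul0r.
Qed.

(** The action on A of the element sum_p p.1 (x) p.2 of A (x) A^op. *)
Definition sum_op (A : nzRingType) (s : seq (A * A)) (y : A) : A :=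
  \sum_(p <- s) p.1 * y * p.2.

Definition mult_op (A : nzRingType) (f : A -> A) : Prop :=
  exists s, f =1 sum_op s.

Definition word_comp (A : nzRingType) (s : nat -> seq (A * A)) (w : seq nat)
  (y : A) : A := foldr (fun i z => sum_op (s i) z) y w.

Lemma sum_opD (A : nzRingType) (s : seq (A * A)) y z :
  sum_op s (y + z) = sum_op s y + sum_op s z.
Proof.
by rewrite /sum_op -big_split; apply: eq_bigr => p _; rewrite mulrDr mulrDl.
Qed.

Lemma sum_op0 (A : nzRingType) (s : seq (A * A)) : sum_op s 0 = 0.
Proof. by rewrite /sum_op big1 // => p _; rewrite mulr0 mul0r. Qed.

Lemma word_comp_eq (A : nzRingType) (s t : nat -> seq (A * A)) w y :
  {in w, s =1 t} -> word_comp s w y = word_comp t w y.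
Proof.
elim: w => //= i w IH st; rewrite IH => [|j jw]; last by rewrite st ?inE ?jw ?orbT.
by rewrite st ?mem_head.
Qed.

Definition upd (T : Type) (s : nat -> T) (m : nat) (l : T) : nat -> T :=
  fun i => if i == m then l else s i.

Lemma word_comp_nil (A : nzRingType) (s : nat -> seq (A * A)) m w y :
  m \in w -> word_comp (upd s m [::]) w y = 0.
Proof.
elim: w => //= i w IH; rewrite inE => /orP[/eqP <-|mw].
  by rewrite /upd eqxx /sum_op big_nil.
by rewrite IH // sum_op0.
Qed.

Lemma word_comp_cons (A : nzRingType) (s : nat -> seq (A * A)) m p l w y :
  uniq w -> m \in w -> word_comp (upd s m (p :: l)) w y =
    word_comp (upd s m [:: p]) w y + word_comp (upd s m l) w y.
Proof.
elim: w => //= i w IH /andP[iw uw]; rewrite inE => /orP[/eqP mi|mw].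
  subst i; have e l' : word_comp (upd s m l') w y = word_comp s w y.
    apply: word_comp_eq => j jw; rewrite /upd; case: eqP => // jm.
    by rewrite jm (negbTE iw) in jw.
  by rewrite !e /upd eqxx /sum_op big_cons big_seq1.
rewrite IH // sum_opD /upd; case: eqP => // im.
by rewrite im mw in iw.
Qed.

Lemma word_comp_single (A : nzRingType) (a b : nat -> A) w y :
  word_comp (fun i => [:: (a i, b i)]) w y =
    word_eval a w * y * word_eval b (rev w).
Proof.
rewrite /word_eval; elim: w => [|i w IH] /=; first by rewrite !big_nil mul1r mulr1.
rewrite IH /sum_op big_seq1 /= rev_cons -cats1 big_cat big_cons big_seq1 /=.
by rewrite !mulrA.
Qed.

(** The preceding identity, extended by multilinearity from the operators
    y |-> a y b to their sums. *)
Lemma operator_identity (A : nzRingType) (k : fieldType)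
    (phi : {rmorphism k -> A}) : PI_property A ->
  exists n (alpha : seq nat -> k),
    (exists2 w0, perm_eq w0 (iota 0 n) & alpha w0 != 0) /\
    forall (s : nat -> seq (A * A)) y,
      \sum_(w <- permutations (iota 0 n)) phi (alpha w) * word_comp s w y = 0.
Proof.
move=> /(multiplication_identity phi)[n [alpha [w0P idA]]].
exists n, alpha; split=> // s y.
pose E s := \sum_(w <- permutations (iota 0 n)) phi (alpha w) * word_comp s w y.
rewrite -/(E s).
have eqE (s1 s2 : nat -> seq (A * A)) : (forall i, (i < n)%N -> s1 i = s2 i) -> E s1 = E s2.
  move=> h; rewrite /E !big_seq; apply: eq_bigr => w.
  rewrite mem_permutations => pw; congr (_ * _); apply: word_comp_eq => i.
  by rewrite (perm_mem pw) mem_iota => /h.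
(* The operators of index i < m may be arbitrary sums, the other ones have a
   single term; the case m = n is the claim. *)
suff S m (s1 : nat -> seq (A * A)) :
    (forall i, (m <= i < n)%N -> size (s1 i) = 1%N) -> E s1 = 0.
  by apply: (S n) => i /andP[h1 h2]; move: (leq_trans h2 h1); rewrite ltnn.
elim: m s1 => [|m IH] s1 hs.
  rewrite -[RHS](idA (fun i => (head (0, 0) (s1 i)).1) (fun i => (head (0, 0) (s1 i)).2) y).
  rewrite -[RHS](eq_bigr _ (fun w _ => congr1 _ (word_comp_single _ _ w y))).
  apply: eqE => i li; have := hs i li.
  by case: (s1 i) => [|[u v] []].
have [lnm|lmn] := leqP n m.
  by apply: IH => i /andP[h1 h2]; move: (leq_trans (leq_trans h2 lnm) h1); rewrite ltnn.
have -> : E s1 = E (upd s1 m (s1 m)).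
  by apply: eqE => i _; rewrite /upd; case: eqP => // ->.
elim: (s1 m) => [|p l IHl].
  rewrite /E big1_seq // => w /andP[_]; rewrite mem_permutations => pw.
  by rewrite word_comp_nil ?mulr0 // (perm_mem pw) mem_iota.
have -> : E (upd s1 m (p :: l)) = E (upd s1 m [:: p]) + E (upd s1 m l).
  rewrite /E -big_split /= !big_seq; apply: eq_bigr => w.
  rewrite mem_permutations => pw; rewrite word_comp_cons ?mulrDr //.
    by rewrite (perm_uniq pw) iota_uniq.
  by rewrite (perm_mem pw) mem_iota.
rewrite IHl addr0; apply: IH => i /andP[h1 h2]; rewrite /upd; case: eqP => // im.
by apply: hs; rewrite ltn_neqAle h1 h2 !andbT; apply/eqP => e; apply: im.
Qed.

Section MultOp.
Variable A : nzRingType.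
Implicit Types f g : A -> A.

Lemma mult_op_id : mult_op (fun y : A => y).
Proof. by exists [:: (1, 1)] => y; rewrite /sum_op big_seq1 mul1r mulr1. Qed.

Lemma mult_opD f g : mult_op f -> mult_op g -> mult_op (fun y => f y + g y).
Proof. by move=> [s fs] [t gt]; exists (s ++ t) => y; rewrite fs gt /sum_op big_cat. Qed.

Lemma mult_op0 f : mult_op f -> f 0 = 0.
Proof. by move=> [s fs]; rewrite fs sum_op0. Qed.

Lemma mult_op_sum n (F : 'I_n -> A -> A) :
  (forall i, mult_op (F i)) -> mult_op (fun y => \sum_i F i y).
Proof.
move=> hF; have /fin_all_exists[s sP] : forall i, exists s, F i =1 sum_op s := hF.
exists (flatten [seq s i | i <- index_enum 'I_n]) => y.
by rewrite /sum_op big_flatten big_map; apply: eq_bigr => i _; rewrite sP.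
Qed.

Lemma mult_op_mul f a b : mult_op f -> mult_op (fun y => a * f y * b).
Proof.
move=> [s fs]; exists [seq (a * p.1, p.2 * b) | p <- s] => y.
rewrite fs /sum_op mulr_sumr mulr_suml big_map; apply: eq_bigr => p _ /=.
by rewrite !mulrA.
Qed.

Lemma mult_op_mull f a : mult_op f -> mult_op (fun y => a * f y).
Proof.
move=> /(@mult_op_mul f a 1)[s fs]; exists s => y.
by rewrite -fs mulr1.
Qed.

Lemma mult_op_mulr f b : mult_op f -> mult_op (fun y => f y * b).
Proof.
move=> /(@mult_op_mul f 1 b)[s fs]; exists s => y.
by rewrite -fs mul1r.
Qed.

Lemma mult_opB f g : mult_op f -> mult_op g -> mult_op (fun y => f y - g y).
Proof.
move=> hf /(mult_op_mull (-1)) hg; have [s sP] := mult_opD hf hg.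
by exists s => y; rewrite -sP mulN1r.
Qed.

Lemma mult_op_comp f g : mult_op f -> mult_op g -> mult_op (fun y => f (g y)).
Proof.
move=> [s fs] hg.
have [t tP] := mult_op_sum (fun i : 'I_(size s) =>
   mult_op_mul (tnth (in_tuple s) i).1 (tnth (in_tuple s) i).2 hg).
by exists t => y; rewrite -tP fs /sum_op big_tnth.
Qed.

End MultOp.

(** * Prime PI rings whose centre is a field *)

Section PrimePI.
Variables (A : nzRingType) (k : fieldType) (phi : {rmorphism k -> A}).
Hypothesis A_prime : prime_ring A.
Implicit Types f g : A -> A.

Lemma prime_neq0 a b : a != 0 -> b != 0 -> exists r : A, a * r * b != 0.
Proof.
move=> /eqP a0 /eqP b0; apply: NNPP => nex.
have [] // := @A_prime a b; move=> r; apply/eqP/negPn/negP => ab.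
by apply: nex; exists r.
Qed.

(** An operator that vanishes on a nonzero ideal is zero.  Induction on the
    number of terms: z |-> f(z) u q - f(z q u), where p z q is one of the terms
    of f, has one term fewer and vanishes on the ideal too.  So
    f(z) u q = f(z q u) for all z, which is 0 for u in the ideal; as A is
    prime, f(z) = 0 or q = 0. *)
Lemma sum_op_vanish (s : seq (A * A)) d : d != 0 ->
  (forall a b, sum_op s (a * d * b) = 0) -> forall y, sum_op s y = 0.
Proof.
move=> d0; have [m] := ubnP (size s); elim: m s => // m IH [|[p q] s] sm hs y.
  by rewrite /sum_op big_nil.
have [q0|q0] := eqVneq q 0.
  have es z : sum_op ((p, q) :: s) z = sum_op s z.
    by rewrite /sum_op big_cons q0 /= mulr0 add0r.
  by rewrite es; apply: IH => // a b; rewrite -es.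
have key z u : sum_op ((p, q) :: s) z * u * q = sum_op ((p, q) :: s) (z * q * u).
  (* The term of index (p, q) cancels, whence the smaller size. *)
  pose s' := [seq (x.1, x.2 * u * q - q * u * x.2) | x <- s].
  have es' x : sum_op s' x =
      sum_op ((p, q) :: s) x * u * q - sum_op ((p, q) :: s) (x * q * u).
    rewrite /sum_op /s' big_map !big_cons /= !mulrDl opprD addrACA.
    rewrite !mulrA subrr add0r !mulr_suml -sumrB; apply: eq_bigr => i _.
    by rewrite mulrBr !mulrA.
  apply/eqP; rewrite -subr_eq0 -es'; apply/eqP; apply: IH.
    by rewrite size_map.
  move=> a b; rewrite es' hs !mul0r sub0r -!(mulrA (a * d)).
  by rewrite hs oppr0.
apply/eqP/negPn/negP => sy0.
have [r dq] := prime_neq0 d0 q0.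
have [r' /eqP] := prime_neq0 sy0 dq; apply.
have -> : sum_op ((p, q) :: s) y * r' * (d * r * q) =
    sum_op ((p, q) :: s) y * (r' * d * r) * q by rewrite !mulrA.
rewrite key; have -> : y * q * (r' * d * r) = (y * q * r') * d * r by rewrite !mulrA.
exact: hs.
Qed.

Lemma mult_op_vanish f d : mult_op f -> d != 0 ->
  (forall a b, f (a * d * b) = 0) -> forall y, f y = 0.
Proof.
move=> [s fs] d0 h y; rewrite fs; apply: (sum_op_vanish d0) => a b.
by rewrite -fs.
Qed.

Lemma mult_op_neq0 f d y : mult_op f -> d != 0 -> f y != 0 ->
  exists a b, f (a * d * b) != 0.
Proof.
move=> hf d0 /eqP fy; apply: NNPP => nex; apply: fy.
apply: (mult_op_vanish hf d0) => a b; apply/eqP/negPn/negP => h.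
by apply: nex; exists a, b.
Qed.

(** Over the extended centroid C, this says that the u_i span the central
    closure AC over C; the formulation spares the construction of C. *)
Definition separating m (u : 'I_m -> A) : Prop :=
  forall f, mult_op f -> (forall i, f (u i) = 0) -> forall y, f y = 0.

Definition in_ideal (v a : A) : Prop := exists2 f, mult_op f & a = f v.

Lemma foldl_sum_op0 (s : nat -> seq (A * A)) t :
  foldl (fun y i => sum_op (s i) y) 0 t = 0.
Proof. by elim: t => //= i t; rewrite sum_op0. Qed.

(** Only the order s_r, s_(r+1), ... climbs the staircase; any other order
    meets some s_i with w_j, j < i, which is 0. *)
Lemma foldl_staircase (s : nat -> seq (A * A)) (w : nat -> A) n r t :
  (forall i, (i < n)%N -> sum_op (s i) (w i) = w i.+1) ->
  (forall i j, (j < i < n)%N -> sum_op (s i) (w j) = 0) ->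
  uniq t -> all (fun i => (r <= i < n)%N) t ->
  foldl (fun y i => sum_op (s i) y) (w r) t =
    if t == iota r (size t) then w (r + size t)%N else 0.
Proof.
move=> s1 s2; elim: t r => [|i t IH] r /=; first by rewrite addn0.
move=> /andP[it ut] /andP[/andP[ri li] al].
rewrite eqseq_cons; have [ir|nir] := eqVneq i r; last first.
  rewrite s2 ?li ?andbT; last by rewrite ltn_neqAle eq_sym nir.
  exact: foldl_sum_op0.
subst i; rewrite s1 // IH // ?addSnnS //.
apply/allP => j jt; have /andP[h1 ->] := allP al _ jt; rewrite andbT ltn_neqAle h1 andbT.
by apply: contraNneq it => ->.
Qed.

(** If no finite family in the ideal of v is separating, then staircases of
    every length can be built.  At each stage, g kills the steps w_j below the
    last one but not the last one, w_l.  Some operator h kills all the steps so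
    far and is not 0 on the ideal of g(w_l), by [mult_op_neq0]; so a multiple
    a g(w_l) b not killed by h is the next step, and h replaces g.  A staircase
    as long as the degree of the operator identity contradicts it. *)
Lemma exists_separating v : PI_property A -> v != 0 ->
  exists m (u : 'I_m -> A), (forall i, in_ideal v (u i)) /\ separating u.
Proof.
move=> /(operator_identity phi)[n [alpha [[w0 pw0 aw0] idA]]] v0.
apply: NNPP => nosep.
have {}nosep m (u : 'I_m -> A) : (forall i, in_ideal v (u i)) ->
    exists f y, [/\ mult_op f, forall i, f (u i) = 0 & f y != 0].
  move=> uv; apply: NNPP => nf; apply: nosep; exists m, u; split => // f hf fu y.
  by apply/eqP/negPn/negP => fy; apply: nf; exists f, y.
have chain l : exists (w : nat -> A) (s : nat -> seq (A * A)) g,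
   [/\ (forall i, in_ideal v (w i)) /\ mult_op g,
       forall i, (i < l)%N -> sum_op (s i) (w i) = w i.+1,
       forall i j, (j < i < l)%N -> sum_op (s i) (w j) = 0,
       forall j, (j < l)%N -> g (w j) = 0
     & g (w l) != 0].
  elim: l => [|l [w [s [g [[wv hg] s1 s2 gw gl]]]]].
    exists (fun=> v), (fun=> [::]), id; split=> // [|i j]; last by rewrite ltn0 andbF.
    by split=> [_|]; [exists id => //|]; exact: mult_op_id.
  have [h [y [hh hw hy]]] := nosep l.+1 (fun i => w i) (fun i => wv i).
  have [a [b hab]] := mult_op_neq0 hh gl hy.
  have hg' : mult_op (fun x => a * g x * b) by apply: mult_op_mul.
  have [t tP] := hg'.
  exists (upd w l.+1 (a * g (w l) * b)), (upd s l t), h; split.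
  - split=> // i; rewrite /upd; case: eqP => // _.
    have [f hf ->] := wv l; exists (fun x => a * g (f x) * b) => //.
    exact: (mult_op_comp hg' hf).
  - move=> i; rewrite ltnS leq_eqVlt => /orP[/eqP ->|il].
      by rewrite /upd !eqxx ltn_eqF // -tP.
    by rewrite /upd !eqSS !ltn_eqF // ?s1 // ltnW.
  - move=> i j /andP[ji il]; rewrite /upd (ltn_eqF (leq_trans ji _)); last by rewrite ltnW.
    move: il; rewrite ltnS leq_eqVlt => /orP[/eqP il|il].
      by rewrite il eqxx -tP gw -?il // mulr0 mul0r.
    by rewrite ltn_eqF // s2 // ji.
  - by move=> j jl; rewrite /upd ltn_eqF // (hw (Ordinal jl)).
  - by rewrite /upd eqxx.
have [w [s [g [[_ hg] s1 s2 _ gn]]]] := chain n.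
have wn : w n != 0 by apply: contraNneq gn => ->; rewrite (mult_op0 hg).
(* The word w0 has a nonzero coefficient; its letters, read from the right
   since operators are composed, are assigned the successive steps. *)
pose S l := s (index l (rev w0)).
have urw : uniq (rev w0) by rewrite rev_uniq (perm_uniq pw0) iota_uniq.
have srw : size (rev w0) = n by rewrite size_rev (perm_size pw0) size_iota.
have comp z : perm_eq z (iota 0 n) ->
    word_comp S z (w 0%N) = if z == w0 then w n else 0.
  move=> pz; pose t := [seq index l (rev w0) | l <- rev z].
  have szt : size t = n by rewrite size_map size_rev (perm_size pz) size_iota.
  have -> : word_comp S z (w 0%N) = foldl (fun y i => sum_op (s i) y) (w 0%N) t.
    rewrite /word_comp -(foldl_rev (fun y i => sum_op (S i) y)) /t.
    by elim: (rev z) (w 0%N) => //= x l IH y0; rewrite IH.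
  have mem l : l \in rev z -> l \in rev w0.
    by rewrite !mem_rev (perm_mem pz) (perm_mem pw0).
  rewrite (foldl_staircase s1 s2).
  - rewrite szt add0n; congr (if _ then _ else _).
    have e0 : [seq index l (rev w0) | l <- rev w0] = iota 0 n.
      rewrite -srw; apply: (@eq_from_nth _ 0%N); first by rewrite size_map size_iota.
      move=> i; rewrite size_map => li; rewrite (nth_map 0%N) // nth_iota //.
      by rewrite index_uniq.
    apply/eqP/eqP => [|zw]; last by rewrite /t zw.
    rewrite -e0 /t => e; apply: (can_inj revK).
    apply: (@eq_from_nth _ 0%N); first by rewrite srw size_rev (perm_size pz) size_iota.
    move=> i li; have := congr1 (fun q => nth 0%N q i) e.
    have li' : (i < size (rev w0))%N by rewrite srw -szt size_map.
    rewrite !(nth_map 0%N) // => /(congr1 (nth 0%N (rev w0))).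
    by rewrite !nth_index // ?mem_nth // mem ?mem_nth.
  - rewrite map_inj_in_uniq ?rev_uniq ?(perm_uniq pz) ?iota_uniq //.
    move=> x y xz yz /(congr1 (nth 0%N (rev w0))).
    by rewrite !nth_index ?mem.
  - apply/allP => i /mapP[l lz ->]; rewrite leq0n /= -[X in (_ < X)%N]srw.
    by rewrite index_mem mem.
have := idA S (w 0%N); rewrite (bigD1_seq w0) ?mem_permutations ?permutations_uniq //=.
rewrite big1_seq ?addr0; last first.
  move=> z /andP[zw]; rewrite mem_permutations => pz.
  by rewrite comp // (negbTE zw) mulr0.
rewrite comp // eqxx => e; case/eqP: wn.
by rewrite -[w n]mul1r -(rmorph1 phi) -(mulVf aw0) rmorphM -mulrA e mulr0.
Qed.

Lemma common_multiple m (d : 'I_m -> A) : (forall i, d i != 0) ->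
  exists2 c, c != 0 & forall i, in_ideal (d i) c.
Proof.
elim: m d => [|m IH] d d0; first by exists 1; [exact: oner_neq0|case].
have [c c0 cP] := IH (fun i => d (lift ord0 i)) (fun i => d0 _).
have [r cr] := prime_neq0 c0 (d0 ord0); exists (c * r * d ord0) => // i.
have [j ->|->] := unliftP ord0 i.
  have [f hf fc] := cP j; exists (fun y => f y * (r * d ord0)).
    exact: mult_op_mulr.
  by rewrite -fc mulrA.
exists (fun y => c * r * y) => //; apply: mult_op_mull; exact: mult_op_id.
Qed.

(** In a separating family of minimal size, omitting u_i leaves a family that
    is not separating, so some operator kills the other members but not u_i.
    Primeness provides a common multiple d of the values at the u_i. *)
Lemma exists_dual_family v : PI_property A -> v != 0 ->
  exists m (u : 'I_m.+1 -> A) (e : 'I_m.+1 -> A -> A) d,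
    [/\ d != 0, forall i, in_ideal v (u i), separating u,
        forall i, mult_op (e i) & forall i j, e i (u j) = if i == j then d else 0].
Proof.
move=> PIA v0.
have [m [u [uv su min]]] : exists m (u : 'I_m -> A),
    [/\ forall i, in_ideal v (u i), separating u
      & forall m' (u' : 'I_m' -> A), (forall i, in_ideal v (u' i)) ->
          separating u' -> (m <= m')%N].
  have [m0 [u0 [u0v su0]]] := exists_separating PIA v0.
  have [l] := ubnP m0; elim: l m0 u0 u0v su0 => // l IH m0 u0 u0v su0 ml.
  have [[m' [u' [u'v su' lt]]]|nex] := classic (exists m' (u' : 'I_m' -> A),
      [/\ forall i, in_ideal v (u' i), separating u' & (m' < m0)%N]).
    by apply: (IH m' u') => //; apply: leq_trans lt _.
  exists m0, u0; split=> // m' u' u'v su'; rewrite leqNgt; apply/negP => lt.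
  by apply: nex; exists m', u'.
case: m u uv su min => [|m] u uv su min.
  have := su id (@mult_op_id A); have /eqP := oner_neq0 A => ne h.
  by case: ne; apply: h; case.
have /fin_all_exists[e eP] i : exists e : A -> A,
    [/\ mult_op e, forall j, j != i -> e (u j) = 0 & e (u i) != 0].
  have : ~ separating (fun j => u (lift i j)).
    by move=> /(min _ _ (fun j => uv (lift i j))); rewrite ltnn.
  move=> nsep; apply: NNPP => nex; apply: nsep => f hf fu.
  apply: su => // j; have [j' ->|->] := unliftP i j; first exact: fu.
  apply/eqP/negPn/negP => fi; apply: nex; exists f; split=> // j'.
  by have [j'' ->|->] := unliftP i j'; rewrite ?eqxx.
have [d d0 dP] := @common_multiple _ (fun i => e i (u i)) (fun i => let: And3 _ _ h := eP i in h).
have /fin_all_exists[g gP] i : exists g, mult_op g /\ d = g (e i (u i)).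
  by have [g hg dg] := dP i; exists g.
exists m, u, (fun i y => g i (e i y)), d; split=> // [i|i j].
  by apply: mult_op_comp; [case: (gP i)|case: (eP i)].
have [hg dg] := gP i; have [he e0 _] := eP i.
have [<-|ij] := eqVneq i j; first by rewrite -dg.
by rewrite e0 ?mult_op0 // eq_sym.
Qed.

Lemma separating_eq m (u : 'I_m -> A) f g : separating u -> mult_op f ->
  mult_op g -> (forall i, f (u i) = g (u i)) -> f =1 g.
Proof.
move=> su hf hg fg y; apply/eqP; rewrite -subr_eq0; apply/eqP.
by apply: (su _ (mult_opB hf hg)) => i; rewrite fg subrr.
Qed.

Lemma sum_delta m (d : A) (F : A -> 'I_m -> A) j : (forall i, F 0 i = 0) ->
  \sum_i F (if i == j then d else 0) i = F d j.
Proof.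
move=> F0; rewrite (bigD1 j) //= eqxx big1 ?addr0 // => i /negbTE ->.
exact: F0.
Qed.

(** The coordinate expansion of y: both sides are operators in y, and agree on
    the u_j. *)
Lemma dual_expansion m (u : 'I_m -> A) e d z y : separating u ->
  (forall i, mult_op (e i)) ->
  (forall i j, e i (u j) = if i == j then d else 0) ->
  d * z * y = \sum_i e i y * z * u i.
Proof.
move=> su he eu; apply: (separating_eq (f := fun y => d * z * y)
  (g := fun y => \sum_i e i y * z * u i) su).
- by apply: mult_op_mull; exact: mult_op_id.
- by apply: mult_op_sum => i; do 2!apply: mult_op_mulr.
move=> j; under eq_bigr => i _ do rewrite eu.
by rewrite (@sum_delta _ d (fun x i => x * z * u i)) // => i; rewrite !mul0r.
Qed.

(** Let C be the extended centroid; e_0 has the form y |-> phi(y) d with phi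
    valued in C ([rank1]).  Take a separating family u'_i = l_i(d) in the ideal
    of d, with dual operators e'_i, normalized by d'; then 1 = sum_i c_i u'_i, with c_i in C and
    c_i d' = e'_i(1) in A.  The element
      T x = sum_i l_i (e_0 (r e'_i(1) a x b)) = sum_i phi(r c_i d' a x b) u'_i
    equals phi(r d' a x b), hence is central; x = d is used.  Without C, this is
    expressed by the equation [dT], from which centrality follows by
    primeness. *)
Lemma exists_central_in_ideal m (u : 'I_m.+1 -> A) e d : PI_property A ->
  d != 0 -> separating u -> (forall i, mult_op (e i)) ->
  (forall i j, e i (u j) = if i == j then d else 0) ->
  exists t, [/\ t != 0, central t & in_ideal d t].
Proof.
move=> PIA d0 su he eu; pose e1 := e ord0.
have [m' [u' [e' [d' [d'0 u'd su' he' eu']]]]] := exists_dual_family PIA d0.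
have /fin_all_exists[l lP] i : exists l, mult_op l /\ u' i = l d.
  by have [l hl ul] := u'd i; exists l.
have [a da] := prime_neq0 d'0 d0.
have e1u : e1 (u ord0) != 0 by rewrite /e1 eu eqxx.
have [r [b e1r]] := mult_op_neq0 (he ord0) da e1u.
pose T x := \sum_i l i (e1 (r * (e' i 1 * a * x * b))).
have hT : mult_op T.
  apply: mult_op_sum => i; apply: (mult_op_comp (lP i).1).
  apply: (mult_op_comp (he ord0)); apply: mult_op_mull; apply: mult_op_mul.
  exact: mult_op_id.
have rank1 g z y : mult_op g -> d * z * g (e1 y) = e1 y * z * g d.
  move=> hg; apply: (separating_eq (f := fun y => d * z * g (e1 y))
    (g := fun y => e1 y * z * g d) su).
  - exact: mult_op_mull (mult_op_comp hg (he ord0)).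
  - by do 2!apply: mult_op_mulr; exact: he.
  - move=> i /=; rewrite /e1 eu; case: eqP => _ //.
    by rewrite (mult_op0 hg) !mul0r mulr0.
have dT z : d * z * T d = e1 (r * (d' * a * d) * b) * z.
  rewrite /T mulr_sumr; have [s es] := he ord0.
  under eq_bigr => i _ do rewrite (rank1 _ _ _ (lP i).1) -(lP i).2 /e1 es.
  rewrite /e1 es /sum_op mulr_suml.
  under eq_bigr => i _ do rewrite !mulr_suml.
  rewrite exchange_big /=; apply: eq_bigr => p _.
  have := dual_expansion (a * d * b * p.2 * z) 1 su' he' eu'.
  rewrite mulr1 => /(congr1 (fun x => p.1 * r * x)); rewrite mulr_sumr => h.
  transitivity (p.1 * r * (d' * (a * d * b * p.2 * z))); last by rewrite !mulrA.
  by rewrite h; apply: eq_bigr => i _; rewrite !mulrA.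
exists (T d); split; last by exists T.
- apply: contraNneq e1r => T0; apply/eqP; have := dT 1; rewrite T0 mulr0 mulr1.
  exact: esym.
- move=> z; apply/eqP; rewrite -subr_eq0; apply/eqP.
  have [] := @A_prime d (T d * z - z * T d) _ => [x|d00|//].
    by rewrite mulrBr mulrA dT (mulrA (d * x)) -(mulrA d x z) dT !mulrA subrr.
  by rewrite d00 eqxx in d0.
Qed.

(** A nonzero central element in the ideal of d is invertible, being in phi k.
    So the dual operators can be composed with an operator sending d to 1. *)
Lemma prime_PI_finite_dim : PI_property A ->
  (forall a, central a <-> exists c, a = phi c) ->
  exists m (u : 'I_m -> A), forall y, exists c : 'I_m -> k,
    y = \sum_i phi (c i) * u i.
Proof.
move=> PIA Zk.
have [m [u [e [d [d0 _ su he eu]]]]] := exists_dual_family PIA (oner_neq0 A).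
have [t [t0 tZ [f hf ft]]] := exists_central_in_ideal PIA d0 su he eu.
have [c tc] := (Zk t).1 tZ.
have c0 : c != 0 by apply: contraNneq t0 => c0; rewrite tc c0 rmorph0.
(* Since f d = t = phi c, these satisfy E i (u j) = delta_ij. *)
pose E i y := phi c^-1 * f (e i y).
have hE i : mult_op (E i) by apply: mult_op_mull; apply: mult_op_comp.
have Eu i j : E i (u j) = if i == j then 1 else 0.
  rewrite /E eu; case: eqP => _; last by rewrite (mult_op0 hf) mulr0.
  by rewrite -ft tc -rmorphM mulVf // rmorph1.
exists m.+1, u => y.
have EZ i : exists c, E i y = phi c.
  apply/Zk => z; apply: (separating_eq (f := fun y => E i y * z)
    (g := fun y => z * E i y) su).
  - exact: mult_op_mulr.
  - exact: mult_op_mull.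
  - by move=> j; rewrite Eu; case: eqP => _; rewrite ?mulr1 ?mul1r ?mulr0 ?mul0r.
have /fin_all_exists[b bP] := EZ.
exists b; rewrite -[LHS]mul1r -[1]mulr1 (dual_expansion 1 y su hE Eu).
by apply: eq_bigr => i _; rewrite mulr1 bP.
Qed.

End PrimePI.

(** * Skew PBW extensions of prime rings are prime *)

Section SkewPBWPrime.
Variables (R A : nzRingType) (iota : {rmorphism R -> A}) (n : nat).
Variables (x : 'I_n -> A) (sigma : 'I_n -> {rmorphism R -> R}).
Variable delta : 'I_n -> R -> R.
Hypothesis sigma_bij : forall i, bijective (sigma i).
Hypothesis x_scalar : forall i r,
  x i * iota r = iota (sigma i r) * x i + iota (delta i r).
Hypothesis x_swap : forall i j : 'I_n, (i < j)%N ->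
  exists c, invertible c /\ quadratic_relation iota x i j c.

Definition word_prod (w : seq 'I_n) : A := \prod_(i <- w) x i.

Lemma word_prod_cons i w : word_prod (i :: w) = x i * word_prod w.
Proof. exact: big_cons. Qed.

Lemma word_prod_cat u v : word_prod (u ++ v) = word_prod u * word_prod v.
Proof. exact: big_cat. Qed.

(** The elements of degree less than p.  Allowing all words, not only the
    increasing ones, makes stability under products immediate; [low_std]
    returns to the standard monomials. *)
Definition low (p : nat) (a : A) : Prop :=
  exists2 ts : seq (R * seq 'I_n), all (fun t => (size t.2 < p)%N) ts
    & a = \sum_(t <- ts) iota t.1 * word_prod t.2.

Lemma low0 p : low p 0.
Proof. by exists [::]; rewrite ?big_nil. Qed.

Lemma lowD p a b : low p a -> low p b -> low p (a + b).
Proof.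
move=> [s hs ->] [t ht ->]; exists (s ++ t); last by rewrite big_cat.
by rewrite all_cat hs.
Qed.

Lemma low_sum (I : eqType) (s : seq I) (P : pred I) (F : I -> A) p :
  (forall i, i \in s -> P i -> low p (F i)) -> low p (\sum_(i <- s | P i) F i).
Proof.
move=> h; rewrite big_seq_cond; apply: big_ind => [||i /andP[]]; last exact: h.
  exact: low0.
exact: lowD.
Qed.

Lemma low_word p r w : (size w < p)%N -> low p (iota r * word_prod w).
Proof. by move=> h; exists [:: (r, w)]; rewrite ?big_seq1 //= h. Qed.

(** An additive map can be estimated on the generators of [low p]. *)
Lemma low_additive p q (f : A -> A) : f 0 = 0 -> {morph f : a b / a + b} ->
  (forall r w, (size w < p)%N -> low q (f (iota r * word_prod w))) ->
  forall a, low p a -> low q (f a).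
Proof.
move=> f0 fD h a [ts + ->]; elim: ts => [|t ts IH] /=.
  by move=> _; rewrite big_nil f0; exact: low0.
by move=> /andP[ht hts]; rewrite big_cons fD; apply: lowD; [exact: h|exact: IH].
Qed.

Lemma low_le p q a : (p <= q)%N -> low p a -> low q a.
Proof.
move=> pq; apply: (@low_additive p q id) => // r w wp; apply: low_word.
exact: leq_trans wp pq.
Qed.

Lemma low_scale p r a : low p a -> low p (iota r * a).
Proof.
apply: (@low_additive p p (fun a => iota r * a)); first by rewrite mulr0.
  by move=> ? ?; rewrite mulrDr.
by move=> s w wp; rewrite mulrA -rmorphM; apply: low_word.
Qed.

Lemma lowN p a : low p a -> low p (- a).
Proof. by move=> /(low_scale (-1)); rewrite rmorphN1 mulN1r. Qed.

Lemma low_mulx p i a : low p a -> low p.+1 (x i * a).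
Proof.
apply: (@low_additive p p.+1 (fun a => x i * a)); first by rewrite mulr0.
  by move=> ? ?; rewrite mulrDr.
move=> r w wp; rewrite mulrA x_scalar mulrDl -mulrA -word_prod_cons.
by apply: lowD; apply: low_word => //; rewrite ltnS ltnW.
Qed.

Lemma low_mulw p a w : low p a -> low (p + size w) (a * word_prod w).
Proof.
apply: (@low_additive p _ (fun a => a * word_prod w)); first by rewrite mul0r.
  by move=> ? ?; rewrite mulrDl.
move=> r u up; rewrite -mulrA -word_prod_cat; apply: low_word.
by rewrite size_cat ltn_add2r.
Qed.

Definition word_twist (w : seq 'I_n) (r : R) : R :=
  foldr (fun i r => sigma i r) r w.

Lemma word_twistM w r s : word_twist w (r * s) = word_twist w r * word_twist w s.
Proof. by elim: w => //= i w ->; rewrite rmorphM. Qed.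

Lemma word_twist_bij w : bijective (word_twist w).
Proof.
elim: w => [|i w IH]; first by exists id.
exact: (bij_comp (sigma_bij i) IH).
Qed.

Lemma word_twist0 w : word_twist w 0 = 0.
Proof. by elim: w => //= i w ->; rewrite rmorph0. Qed.

Lemma word_scalar w r :
  low (size w) (word_prod w * iota r - iota (word_twist w r) * word_prod w).
Proof.
elim: w => [|i w IH] /=; first by rewrite /word_prod big_nil mul1r mulr1 subrr; exact: low0.
rewrite !word_prod_cons; set s := word_twist w r in IH *.
have -> : x i * word_prod w * iota r - iota (sigma i s) * (x i * word_prod w) =
   x i * (word_prod w * iota r - iota s * word_prod w) + iota (delta i s) * word_prod w.
  rewrite mulrBr !mulrA x_scalar mulrDl opprD -!addrA; congr (_ + _).
  by rewrite addNr addr0.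
by apply: lowD; [exact: low_mulx|exact: low_word].
Qed.

(** The words w and w' are associated modulo lower degree, when they have
    the same length. *)
Definition word_assoc (w w' : seq 'I_n) : Prop := exists2 c, invertible c &
  low (size w) (word_prod w - iota c * word_prod w').

Lemma invertible1 : @invertible R 1.
Proof. by exists 1; rewrite mulr1. Qed.

Lemma invertibleM (c d : R) : invertible c -> invertible d -> invertible (c * d).
Proof.
move=> [c' [h1 h2]] [d' [h3 h4]]; exists (d' * c'); split.
  by rewrite mulrA -(mulrA c) h3 mulr1.
by rewrite mulrA -(mulrA d') h2 mulr1.
Qed.

Lemma invertible_morph (f : {rmorphism R -> R}) c : invertible c -> invertible (f c).
Proof. by move=> [d [h1 h2]]; exists (f d); rewrite -!rmorphM h1 h2 rmorph1. Qed.

Lemma word_assoc_refl w : word_assoc w w.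
Proof.
exists 1; first exact: invertible1.
by rewrite rmorph1 mul1r subrr; exact: low0.
Qed.

Lemma word_assoc_trans u v w : size u = size v -> word_assoc u v -> word_assoc v w -> word_assoc u w.
Proof.
move=> suv [c ic hc] [d id hd]; exists (c * d); first exact: invertibleM.
have -> : word_prod u - iota (c * d) * word_prod w =
  (word_prod u - iota c * word_prod v) + iota c * (word_prod v - iota d * word_prod w).
  by rewrite rmorphM mulrBr addrA subrK mulrA.
by apply: lowD => //; apply: low_scale; rewrite suv.
Qed.

Lemma word_assoc_cons i u v : size u = size v -> word_assoc u v -> word_assoc (i :: u) (i :: v).
Proof.
move=> suv [c ic hc]; exists (sigma i c); first exact: invertible_morph.
rewrite !word_prod_cons /=.
have -> : x i * word_prod u - iota (sigma i c) * (x i * word_prod v) =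
   x i * (word_prod u - iota c * word_prod v) + iota (delta i c) * word_prod v.
  rewrite mulrBr !mulrA x_scalar mulrDl opprD -!addrA; congr (_ + _).
  by rewrite addNr addr0.
by apply: lowD; [exact: low_mulx|apply: low_word; rewrite suv].
Qed.

Lemma low_quad w (i j : 'I_n) c : quadratic_relation iota x i j c ->
  low (size w).+2 (x j * (x i * word_prod w) - iota c * (x i * (x j * word_prod w))).
Proof.
move=> [r0 [r h]].
have -> : x j * (x i * word_prod w) - iota c * (x i * (x j * word_prod w)) =
    (x j * x i - iota c * (x i * x j)) * word_prod w.
  by rewrite mulrBl !mulrA.
rewrite h mulrDl; apply: lowD; first by apply: low_word; rewrite ltnW.
rewrite mulr_suml; apply: low_sum => k _ _; rewrite -mulrA -word_prod_cons.
exact: low_word.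
Qed.

(** The quadratic relations are assumed with an invertible coefficient for
    i < j only; in the other case, the relation for (j, i) is solved by
    inverting its coefficient. *)
Lemma word_assoc_swap i j w : word_assoc (j :: i :: w) (i :: j :: w).
Proof.
have [lt|lt|e] := ltngtP i j; last by rewrite (val_inj e); exact: word_assoc_refl.
  have [c [ic h]] := x_swap lt; exists c => //.
  by rewrite !word_prod_cons; apply: low_quad.
have [c [[d [cd dc]] h]] := x_swap lt; exists d; first by exists c.
rewrite !word_prod_cons.
have -> : x j * (x i * word_prod w) - iota d * (x i * (x j * word_prod w)) =
  iota (- d) * (x i * (x j * word_prod w) - iota c * (x j * (x i * word_prod w))).
  rewrite mulrBr !rmorphN !mulNr opprK addrC; congr (_ + _).
  by rewrite [RHS]mulrA -rmorphM dc rmorph1 mul1r.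
by apply: low_scale; apply: low_quad.
Qed.

Lemma word_assoc_insert i u v : word_assoc (i :: u ++ v) (u ++ i :: v).
Proof.
elim: u => [|a u IH] /=; first exact: word_assoc_refl.
apply: (word_assoc_trans _ (word_assoc_swap _ _ _)) => //.
by apply: word_assoc_cons => //; rewrite /= !size_cat /= addnS.
Qed.

Lemma perm_word_assoc u v : perm_eq u v -> word_assoc u v.
Proof.
elim: u v => [|i u IH] v.
  by rewrite perm_sym => /perm_nilP ->; exact: word_assoc_refl.
move=> puv; have iv : i \in v by rewrite -(perm_mem puv) mem_head.
case/splitPr: v / iv puv => v1 v2 puv.
have pu : perm_eq u (v1 ++ v2).
  by rewrite -(perm_cons i); apply: perm_trans puv _; rewrite -[i :: v2]cat1s perm_catCA.
apply: (word_assoc_trans _ _ (word_assoc_insert i v1 v2)); first by rewrite /= (perm_size pu).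
by apply: word_assoc_cons; [exact: perm_size|exact: IH].
Qed.

Definition std_word (alpha : {ffun 'I_n -> nat}) : seq 'I_n :=
  flatten [seq nseq (alpha i) i | i <- enum 'I_n].

Lemma std_monomE alpha : std_monom x alpha = word_prod (std_word alpha).
Proof.
rewrite /word_prod /std_word big_flatten big_map big_enum_ord.
by apply: eq_bigr => i _; rewrite big_nseq iter_mulr_1.
Qed.

Lemma count_std_word alpha i : count_mem i (std_word alpha) = alpha i.
Proof.
rewrite /std_word count_flatten -map_comp sumnE big_map big_enum_ord.
rewrite (bigD1 i) //= count_nseq /= eqxx mul1n big1 ?addn0 // => j ji.
by rewrite count_nseq /= (negbTE ji) mul0n.
Qed.

Definition expo_deg (alpha : {ffun 'I_n -> nat}) : nat := \sum_i alpha i.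

Definition content (w : seq 'I_n) : {ffun 'I_n -> nat} := [ffun i => count_mem i w].

Lemma size_std_word alpha : size (std_word alpha) = expo_deg alpha.
Proof.
rewrite /std_word size_flatten /shape -map_comp sumnE big_map big_enum_ord.
by apply: eq_bigr => i _; rewrite /= size_nseq.
Qed.

Lemma perm_std_word w : perm_eq w (std_word (content w)).
Proof. by apply/allP => i _ /=; rewrite count_std_word ffunE. Qed.

Lemma expo_deg_content w : expo_deg (content w) = size w.
Proof. by rewrite -size_std_word (perm_size (perm_std_word w)). Qed.

(** Sorting the top-degree words of an element by [perm_word_assoc] leaves
    errors of lower degree, which are treated by induction. *)
Lemma low_std p a : low p a -> exists2 ts : seq (R * {ffun 'I_n -> nat}),
  all (fun t => (expo_deg t.2 < p)%N) ts
  & a = \sum_(t <- ts) iota t.1 * std_monom x t.2.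
Proof.
elim: p a => [|p IH] a [ts].
  by case: ts => // _ ->; exists [::]; rewrite ?big_nil.
move=> + ->; elim: ts => [|[r w] ts IHt] /=.
  by move=> _; exists [::]; rewrite ?big_nil.
move=> /andP[sw /IHt[us us1 us2]]; rewrite big_cons us2 /=.
suff [vs vs1 vs2] : exists2 ts : seq (R * {ffun 'I_n -> nat}),
    all (fun t => (expo_deg t.2 < p.+1)%N) ts
    & iota r * word_prod w = \sum_(t <- ts) iota t.1 * std_monom x t.2.
  exists (vs ++ us); first by rewrite all_cat vs1.
  by rewrite big_cat vs2.
have [c _ hc] := perm_word_assoc (perm_std_word w).
have /(low_scale r)/IH[vs vs1 vs2] := low_le (sw : (size w <= p)%N) hc.
exists ((r * c, content w) :: vs).
  rewrite /= expo_deg_content sw; apply: sub_all vs1 => t; exact: ltnW.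
by rewrite big_cons /= -vs2 std_monomE mulrBr rmorphM mulrA addrC subrK.
Qed.

Definition expo_add (alpha beta : {ffun 'I_n -> nat}) : {ffun 'I_n -> nat} :=
  [ffun i => (alpha i + beta i)%N].

Lemma expo_deg_add alpha beta :
  expo_deg (expo_add alpha beta) = (expo_deg alpha + expo_deg beta)%N.
Proof. by rewrite /expo_deg -big_split; apply: eq_bigr => i _; rewrite ffunE. Qed.

(** The product of two terms, modulo lower degree: the scalar s crosses the
    monomial alpha, then the two monomials are merged. *)
Lemma std_monomM alpha beta : exists2 c, invertible c & forall r s,
  low (expo_deg alpha + expo_deg beta)
   (iota r * std_monom x alpha * (iota s * std_monom x beta) -
    iota (r * word_twist (std_word alpha) s * c) * std_monom x (expo_add alpha beta)).
Proof.
have pe : perm_eq (std_word alpha ++ std_word beta) (std_word (expo_add alpha beta)).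
  by apply/allP => i _ /=; rewrite count_cat !count_std_word ffunE.
have [c ic] := perm_word_assoc pe; rewrite size_cat !size_std_word => hc.
exists c => // r s; rewrite !std_monomE.
set u := std_word alpha in hc *; set v := std_word beta in hc *.
set w := std_word _ in hc *; set s' := word_twist u s.
have -> : iota r * word_prod u * (iota s * word_prod v) -
    iota (r * s' * c) * word_prod w =
  iota r * ((word_prod u * iota s - iota s' * word_prod u) * word_prod v) +
  iota (r * s') * (word_prod (u ++ v) - iota c * word_prod w).
  rewrite word_prod_cat mulrBl !mulrBr !rmorphM !mulrA.
  by rewrite addrA subrK.
apply: lowD; apply: low_scale => //.
by rewrite -!size_std_word; apply: low_mulw; apply: word_scalar.
Qed.

(** Linear independence for lists of terms in which an exponent may be
    repeated, so that expansions can be concatenated. *)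
Lemma coef_zero (ts : seq (R * {ffun 'I_n -> nat})) gamma :
  left_basis iota (std_monom x) ->
  \sum_(t <- ts) iota t.1 * std_monom x t.2 = 0 ->
  \sum_(t <- ts | t.2 == gamma) t.1 = 0.
Proof.
move=> [_ free] h; pose s := undup [seq t.2 | t <- ts].
have hs : \sum_(g <- s) iota (\sum_(t <- ts | t.2 == g) t.1) * std_monom x g = 0.
  rewrite -[RHS]h [RHS]big_seq.
  transitivity (\sum_(g <- s) \sum_(t <- ts | t.2 == g) iota t.1 * std_monom x t.2).
    apply: eq_bigr => g _; rewrite rmorph_sum mulr_suml.
    by apply: eq_bigr => t /eqP ->.
  rewrite (exchange_big_dep predT) //= [LHS]big_seq; apply: eq_bigr => t tts.
  rewrite -big_filter (bigD1_seq t.2) ?filter_uniq ?undup_uniq //=; last first.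
    by rewrite mem_filter eqxx mem_undup map_f.
  rewrite [X in _ + X]big1_seq ?addr0 // => g; rewrite mem_filter.
  by move=> /and3P[/negbTE gt /eqP tg _]; rewrite tg eqxx in gt.
have [gs|ngs] := boolP (gamma \in s); first exact: (free s _ (undup_uniq _) hs).
rewrite big1_seq // => t /andP[/eqP tg tts]; case/negP: ngs.
by rewrite mem_undup -tg map_f.
Qed.

Lemma reduced_expansion a : left_basis iota (std_monom x) -> a != 0 ->
  exists (s : seq {ffun 'I_n -> nat}) c, [/\ uniq s, s != [::],
    forall al, al \in s -> c al != 0
    & a = \sum_(al <- s) iota (c al) * std_monom x al].
Proof.
move=> [gen _] a0; have [s [c ac]] := gen a.
pose c' al := c al *+ count_mem al s.
pose s' := [seq al <- undup s | c' al != 0].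
have as' : a = \sum_(al <- s') iota (c' al) * std_monom x al.
  rewrite big_filter big_mkcond ac -big_undup_iterop_count.
  apply: eq_bigr => al _; rewrite /c'; case: eqP => [c0|_] /=.
    by rewrite Monoid.iteropE iter_addr_0 -mulrnAl -rmorphMn c0 rmorph0 mul0r.
  by rewrite Monoid.iteropE iter_addr_0 -mulrnAl -rmorphMn.
exists s', c'; split=> //; first by rewrite filter_uniq ?undup_uniq.
  by apply: contraNneq a0 => s0; rewrite as' s0 big_nil.
by move=> al; rewrite mem_filter => /andP[].
Qed.

Lemma seq_max (T : eqType) (s : seq T) (h : T -> nat) : s != [::] ->
  exists2 a, a \in s & forall b, b \in s -> (h b <= h a)%N.
Proof.
elim: s => // a s IH _; have [->|/IH[b bs hb]] := eqVneq s [::].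
  by exists a; rewrite ?mem_head // => b; rewrite inE => /eqP ->.
have [le|/ltnW le] := leqP (h a) (h b).
  exists b => [|c]; first by rewrite inE bs orbT.
  by rewrite inE => /orP[/eqP ->|/hb].
exists a => [|c]; first exact: mem_head.
by rewrite inE => /orP[/eqP -> //|/hb hc]; apply: leq_trans hc le.
Qed.

(** An additive weight which, on exponents of degree below B, is injective.
    Maximizing it among the terms of top degree selects a leading term, and
    additivity shows that the leading exponent of a product is obtained from
    the two leading exponents only. *)
Definition expo_weight (B : nat) (al : {ffun 'I_n -> nat}) : nat :=
  \sum_(i < n) al i * B ^ i.

Lemma expo_weight_add B al be :
  expo_weight B (expo_add al be) = (expo_weight B al + expo_weight B be)%N.
Proof.
by rewrite /expo_weight -big_split; apply: eq_bigr => i _; rewrite ffunE mulnDl.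
Qed.

Lemma base_expansion_inj B m (f g : nat -> nat) :
  (forall i, (f i < B)%N) -> (forall i, (g i < B)%N) ->
  (\sum_(i < m) f i * B ^ i = \sum_(i < m) g i * B ^ i)%N ->
  forall i, (i < m)%N -> f i = g i.
Proof.
move=> + +; elim: m f g => // m IH f g fB gB.
have E (h : nat -> nat) : (\sum_(i < m.+1) h i * B ^ i =
    (\sum_(i < m) h i.+1 * B ^ i) * B + h 0)%N.
  rewrite big_ord_recl expn0 muln1 addnC; congr (_ + _)%N.
  by rewrite big_distrl; apply: eq_bigr => i _; rewrite /= /bump /= expnSr mulnA.
rewrite !E => e.
have B0 : (0 < B)%N := leq_ltn_trans (leq0n _) (fB 0%N).
have e0 : f 0%N = g 0%N.
  by have := congr1 (modn^~ B) e; rewrite /= !modnMDl !modn_small.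
move=> [|i] // im; apply: (IH (fun i => f i.+1) (fun i => g i.+1)) => //.
by apply/eqP; rewrite -(eqn_pmul2r B0) -(eqn_add2r (f 0%N)) {2}e0 e.
Qed.

Lemma expo_weight_inj B al be : (expo_deg al < B)%N -> (expo_deg be < B)%N ->
  expo_weight B al = expo_weight B be -> al = be.
Proof.
move=> alB beB e.
pose F (ga : {ffun 'I_n -> nat}) (i : nat) : nat :=
  if insub i is Some j then ga j else 0%N.
have FE ga (j : 'I_n) : F ga j = ga j by rewrite /F valK.
have FB ga i : (expo_deg ga < B)%N -> (F ga i < B)%N.
  move=> gB; apply: leq_ltn_trans gB; rewrite /F; case: insubP => // j _ _.
  by rewrite /expo_deg (bigD1 j) //= leq_addr.
apply/ffunP => i; rewrite -!FE.
apply: (@base_expansion_inj B n) => // [j|j|]; [exact: FB|exact: FB|].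
rewrite /expo_weight in e.
by under eq_bigr => j _ do rewrite FE; rewrite e; under [RHS]eq_bigr => j _ do rewrite FE.
Qed.

(** The coefficient of f r g at the sum of the two leading exponents is
    C r al be: by [std_monomM] other pairs of exponents contribute in lower
    degree or at other exponents.  Its vanishing for all r gives, since the
    twist by al is surjective, a(al) R twist(b(be)) = 0. *)
Lemma skew_PBW_prime : injective iota -> left_basis iota (std_monom x) ->
  prime_ring R -> prime_ring A.
Proof.
move=> iota_inj basis R_prime f g fg0.
have [->|f0] := eqVneq f 0; first by left.
have [->|g0] := eqVneq g 0; first by right.
exfalso.
have [s [a [us s0 sa ef]]] := reduced_expansion basis f0.
have [t [b [ut t0 tb eg]]] := reduced_expansion basis g0.
have [c cP] : exists c : {ffun 'I_n -> nat} -> {ffun 'I_n -> nat} -> R,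
    forall al be, invertible (c al be) /\ forall r s,
    low (expo_deg al + expo_deg be)
     (iota r * std_monom x al * (iota s * std_monom x be) -
      iota (r * word_twist (std_word al) s * c al be) * std_monom x (expo_add al be)).
  have h al be : exists c, invertible c /\ forall r s,
    low (expo_deg al + expo_deg be)
     (iota r * std_monom x al * (iota s * std_monom x be) -
      iota (r * word_twist (std_word al) s * c) * std_monom x (expo_add al be)).
    by have [c] := std_monomM al be; exists c.
  exists (fun al be => sval (constructive_indefinite_description _ (h al be))).
  by move=> al be; case: constructive_indefinite_description.
have lead (u : seq {ffun 'I_n -> nat}) : u != [::] -> exists p, forall B, (p < B)%N ->
    exists al, [/\ al \in u, expo_deg al = p, forall be, be \in u -> (expo_deg be <= p)%N &
      forall be, be \in u -> expo_deg be = p -> (expo_weight B be <= expo_weight B al)%N].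
  move=> u0; have [al0 al0u al0P] := seq_max expo_deg u0; exists (expo_deg al0) => B _.
  pose v := [seq be <- u | expo_deg be == expo_deg al0].
  have v0 : v != [::].
    have : al0 \in v by rewrite mem_filter eqxx.
    by case: (v).
  have [al] := seq_max (expo_weight B) v0.
  rewrite mem_filter => /andP[/eqP dal alu] alP; exists al; split=> // be beu dbe.
  by apply: alP; rewrite mem_filter beu dbe eqxx.
have [p pP] := lead s s0; have [q qP] := lead t t0.
(* Large enough for the weight to separate exponents of degree p or q. *)
pose B := (p + q).+1.
have [|al [als dal smax wmax]] := pP B; first by rewrite ltnS leq_addr.
have [|be [bet dbe tmax wmax']] := qP B; first by rewrite ltnS leq_addl.
(* The exponent al + be arises from a single pair of top-degree exponents. *)
have uniq_lead al' be' : al' \in s -> be' \in t -> expo_deg al' = p ->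
    expo_deg be' = q -> expo_add al' be' = expo_add al be -> al' = al /\ be' = be.
  move=> al's be't dal' dbe' e.
  have w1 := wmax _ al's dal'; have w2 := wmax' _ be't dbe'.
  have := congr1 (expo_weight B) e; rewrite !expo_weight_add => we.
  split; apply: (@expo_weight_inj B); rewrite ?dal ?dbe ?dal' ?dbe' ?ltnS ?leq_addr ?leq_addl //.
    by apply/eqP; rewrite eqn_leq w1 -(leq_add2r (expo_weight B be')) we leq_add2l.
  by apply/eqP; rewrite eqn_leq w2 -(leq_add2l (expo_weight B al')) we leq_add2r.
pose C r al' be' := a al' * word_twist (std_word al') (r * b be') * c al' be'.
have top r : C r al be = 0.
  pose top_sum := \sum_(al' <- s | expo_deg al' == p) \sum_(be' <- t | expo_deg be' == q)
     iota (C r al' be') * std_monom x (expo_add al' be').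
  have : low (p + q) (f * iota r * g - top_sum).
    have -> : f * iota r * g = \sum_(al' <- s) \sum_(be' <- t)
        iota (a al') * std_monom x al' * (iota (r * b be') * std_monom x be').
      rewrite {1}ef eg -mulrA mulr_suml; apply: eq_bigr => al' _.
      rewrite !mulr_sumr; apply: eq_bigr => be' _.
      by rewrite rmorphM !mulrA.
    rewrite /top_sum [X in low _ (_ - X)]big_mkcond -sumrB; apply: low_sum => al' al's _.
    have [dal'|ndal'] := eqVneq (expo_deg al') p; last first.
      have ltp : (expo_deg al' < p)%N by rewrite ltn_neqAle ndal' smax.
      rewrite subr0; apply: low_sum => be' be't _.
      have lt : (expo_deg al' + expo_deg be' < p + q)%N.
        by rewrite -addSn leq_add // tmax.
      rewrite -[X in low _ X](subrK (iota (C r al' be') * std_monom x (expo_add al' be'))).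
      apply: lowD; first exact: low_le (ltnW lt) ((cP al' be').2 _ _).
      by rewrite std_monomE; apply: low_word; rewrite size_std_word expo_deg_add.
    rewrite [X in low _ (_ - X)]big_mkcond -sumrB; apply: low_sum => be' be't _.
    have [dbe'|ndbe'] := eqVneq (expo_deg be') q.
      by rewrite -[in low _]dal' -[in low _]dbe'; exact: (cP al' be').2.
    have lt : (expo_deg al' + expo_deg be' < p + q)%N.
      by rewrite dal' ltn_add2l ltn_neqAle ndbe' tmax.
    rewrite subr0 -[X in low _ X](subrK (iota (C r al' be') * std_monom x (expo_add al' be'))).
    apply: lowD; first exact: low_le (ltnW lt) ((cP al' be').2 _ _).
    by rewrite std_monomE; apply: low_word; rewrite size_std_word expo_deg_add.
  rewrite fg0 => /low_std[us1 us2 us3].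
  pose vs := [seq (C r al' be', expo_add al' be') |
    al' <- [seq al' <- s | expo_deg al' == p], be' <- [seq be' <- t | expo_deg be' == q]].
  have := coef_zero (ts := vs ++ us1) (expo_add al be) basis.
  rewrite big_cat -us3 /vs big_allpairs_dep big_filter /=.
  under [X in X + _ = 0 -> _]eq_bigr => al' _ do rewrite big_filter.
  rewrite -/top_sum sub0r subrr => /(_ erefl).
  rewrite big_cat /= [X in _ + X]big1_seq ?addr0; last first.
    move=> u /andP[/eqP e uus]; move/allP: us2 => /(_ _ uus).
    by rewrite e expo_deg_add dal dbe ltnn.
  rewrite big_mkcond big_allpairs_dep /= (bigD1_seq al) ?filter_uniq //=; last first.
    by rewrite mem_filter dal eqxx.
  rewrite [X in _ + X]big1_seq ?addr0; last first.
    move=> al' /andP[nal]; rewrite mem_filter => /andP[/eqP dal' al's].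
    rewrite big1_seq // => be' /=; rewrite mem_filter => /andP[/eqP dbe' be't].
    case: eqP => // e; have [eal _] := uniq_lead _ _ al's be't dal' dbe' e.
    by rewrite eal eqxx in nal.
  rewrite (bigD1_seq be) ?filter_uniq //=; last by rewrite mem_filter dbe eqxx.
  rewrite eqxx [X in _ + X]big1_seq ?addr0 // => be' /andP[nbe].
  rewrite mem_filter => /andP[/eqP dbe' be't]; case: eqP => // e.
  have [_ ebe] := uniq_lead _ _ als be't dal dbe' e.
  by rewrite ebe eqxx in nbe.
have [d [cd _]] := (cP al be).1.
have [tinv tK Kt] := word_twist_bij (std_word al).
have [||] := R_prime (a al) (word_twist (std_word al) (b be)).
- move=> r; have := congr1 (fun z => z * d) (top (tinv r)).
  by rewrite /C word_twistM Kt mul0r -mulrA cd mulr1 mulrA.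
- by move=> e; have := sa _ als; rewrite e eqxx.
- rewrite -(word_twist0 (std_word al)) => /(can_inj tK) b0.
  by have := tb _ bet; rewrite b0 eqxx.
Qed.

End SkewPBWPrime.

(** * The centre of a PI skew PBW extension *)

(** More powers of x_0 than members of u would satisfy a nontrivial relation
    over k, against the freeness of the standard monomials. *)
Lemma powers_not_spanned (k : fieldType) (R : algType k) (A : nzRingType)
    (iota : {rmorphism R -> A}) n (x : 'I_n.+1 -> A) m (u : 'I_m -> A) :
  left_basis iota (std_monom x) ->
  ~ (forall y, exists c : 'I_m -> k, y = \sum_i iota (c i)%:A * u i).
Proof.
move=> [_ free] span.
have /fin_all_exists[c cP] := fun j : 'I_m.+1 => span (x ord0 ^+ j).
have [|b [[j0 bj0] bP]] := @kernel_vector k 'I_m.+1 'I_m c; first by rewrite !card_ord.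
pose al (j : nat) : {ffun 'I_n.+1 -> nat} := [ffun i => if i == ord0 then j else 0%N].
have xal j : std_monom x (al j) = x ord0 ^+ j.
  rewrite /std_monom big_ord_recl ffunE eqxx big1 ?mulr1 // => i _.
  by rewrite ffunE expr0.
have al_inj : injective al.
  by move=> i j /(congr1 (fun g : {ffun _} => g ord0)); rewrite !ffunE.
pose B (g : {ffun 'I_n.+1 -> nat}) : R :=
  (if insub (g ord0) is Some j then b j else 0)%:A.
have BE (j : 'I_m.+1) : B (al j) = (b j)%:A by rewrite /B ffunE eqxx valK.
have us : uniq [seq al j | j : 'I_m.+1 <- enum 'I_m.+1].
  by rewrite map_inj_uniq ?enum_uniq // => i j /al_inj /val_inj.
have := free _ B us _ (al j0); rewrite (map_f (fun j : 'I_m.+1 => al j)) ?mem_enum // => h.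
have /eqP : B (al j0) = 0.
  apply: h => //; rewrite big_map big_enum /=.
  transitivity (\sum_j \sum_i iota (b j * c j i)%:A * u i).
    apply: eq_bigr => j _; rewrite BE xal cP mulr_sumr; apply: eq_bigr => i _.
    by rewrite mulrA -rmorphM -scalerAl mul1r scalerA.
  rewrite exchange_big big1 //= => i _.
  by rewrite -mulr_suml -rmorph_sum -scaler_suml bP scale0r rmorph0 mul0r.
by rewrite BE scaler_eq0 oner_eq0 orbF (negbTE bj0).
Qed.

Theorem theorem2p24 (k : fieldType) (k_char0 : [pchar k] =i pred0)
    (R : algType k) (R_prime : prime_ring R)
    (A : nzRingType) (iota : {rmorphism R -> A})
    (n : nat) (n_ge1 : (1 <= n)%N) (x : 'I_n -> A)
    (A_PBW : bijective_skew_PBW iota x)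
    (A_PI : PI_property A) :
  ~ trivial_center iota.
Proof.
case: n n_ge1 x A_PBW => // n _ x [[iota_inj basis _ _] sigmaP unitP] Zk.
have /fin_all_exists[sigma /fin_all_exists[delta sdP]] := sigmaP.
have A_prime : prime_ring A.
  apply: (@skew_PBW_prime R A iota n.+1 x sigma (fun i => delta i)) => //.
  - by move=> i; case: (sdP i).
  - by move=> i; case: (sdP i).
pose phi : k -> A := fun c => iota c%:A.
have phiB : zmod_morphism phi.
  by move=> c d; rewrite /phi scalerBl rmorphB.
have phiM : monoid_morphism phi.
  split=> [|c d]; first by rewrite /phi scale1r rmorph1.
  by rewrite /phi -rmorphM -scalerAl mul1r scalerA.
pose phiZ := GRing.isZmodMorphism.Build k A phi phiB.
pose phiR := GRing.isMonoidMorphism.Build k A phi phiM.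
pose Phi : {rmorphism k -> A} := HB.pack phi phiZ phiR.
have [m [u span]] := @prime_PI_finite_dim A k Phi A_prime A_PI Zk.
exact: powers_not_spanned basis span.
Qed.
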